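(* Let $K \subset \mathbb{R}^{2}$ be a Borel set with $\dim_{\mathrm{H}} K > 0$, and let $$\mathrm{Inv}_{T}(K) := \{x \in \mathbb{R}^{2} : \dim_{\mathrm{H}} \pi_{x}(K \setminus \{x\}) = 0\}.$$ Then at least one of the following holds: (1) $\dim_{\mathrm{H}} \mathrm{Inv}_{T}(K) = 0$; (2) $\mathrm{Inv}_{T}(K)$ is contained on a line.
   Context: For $x \in \mathbb{R}^{2}$, the radial projection $\pi_{x} \colon \mathbb{R}^{2} \setminus \{x\} \to S^{1}$ is $\pi_{x}(y) = \frac{y - x}{|y - x|}$. $\dim_{\mathrm{H}}$ denotes Hausdorff dimension. *)

(* Defs.v *)
From mathcomp Require Import all_boot all_order all_algebra.
From mathcomp Require Import all_classical all_reals all_analysis.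
Set Implicit Arguments.
Unset Strict Implicit.
Unset Printing Implicit Defensive.
Import Order.TTheory GRing.Theory Num.Theory.
Import numFieldNormedType.Exports.
Local Open Scope classical_set_scope.
Local Open Scope ring_scope.

(* On 'rV[R]_n the library norm `|x| is the sup norm, so the Euclidean norm is
   defined separately; both induce the library topology. *)
Definition enorm (R : realType) (n : nat) (x : 'rV[R]_n) : R :=
  Num.sqrt (\sum_(i < n) x 0 i ^+ 2).

Definition borel_set (T : topologicalType) (A : set T) : Prop :=
  <<s [set U : set T | open U] >> A.

(* Adding 0 to the set of distances only serves to make the diameter of the
   empty set equal to 0 instead of -oo. *)
Definition diam (R : realType) (n : nat) (A : set 'rV[R]_n) : \bar R :=
  ereal_sup (0%E |` [set (enorm (p.1 - p.2))%:E | p in A `*` A]).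

(* diam(A)^s, with the convention that the empty set contributes 0 even when
   s = 0 (whereas 0 `^ 0 = 1, as needed for points). *)
Definition diam_pow (R : realType) (n : nat) (s : R) (A : set 'rV[R]_n) :
    \bar R :=
  if A == set0 then 0%E else (diam A `^ s)%E.

Definition hausdorff_premeasure (R : realType) (n : nat) (s delta : R)
    (A : set 'rV[R]_n) : \bar R :=
  ereal_inf [set (\sum_(0 <= k <oo) diam_pow s (F k))%E |
    F in [set F : nat -> set 'rV[R]_n |
           A `<=` \bigcup_k F k /\ forall k, (diam (F k) <= delta%:E)%E]].

(* The limit as delta decreases to 0, which is a supremum by monotonicity. *)
Definition hausdorff_measure (R : realType) (n : nat) (s : R)
    (A : set 'rV[R]_n) : \bar R :=
  ereal_sup [set hausdorff_premeasure s delta A |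
    delta in [set delta : R | 0 < delta]].

Definition hausdorff_dim (R : realType) (n : nat) (A : set 'rV[R]_n) : \bar R :=
  ereal_inf [set s%:E |
    s in [set s : R | 0 <= s /\ hausdorff_measure s A = 0%E]].

(* Only meaningful for y != x; at y = x it takes the junk value 0. The circle
   is regarded as a subset of the plane, with the induced Euclidean metric. *)
Definition radial_proj (R : realType) (x y : 'rV[R]_2) : 'rV[R]_2 :=
  (enorm (y - x))^-1 *: (y - x).

Definition InvT (R : realType) (K : set 'rV[R]_2) : set 'rV[R]_2 :=
  [set x | hausdorff_dim (radial_proj x @` (K `\ x)) = 0%E].

Definition is_line (R : realType) (L : set 'rV[R]_2) : Prop :=
  exists a v : 'rV[R]_2, v != 0 /\ L = [set a + t *: v | t in [set: R]].

(* Main.v *)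
(** If [K] meets some line [l] in a set of positive dimension, then every
    [x] outside [l] sees [K] in positive dimension, because [pi_x] is locally
    bi-Lipschitz on [l]; hence [InvT K] lies on [l].

    Otherwise [K] carries (on a compact subset) a Frostman measure [mu] which
    gives uniformly small mass to thin strips. At a scale [t], call a strip of
    width [t^8] heavy if its mass is at least [t^(s/4)]. By Bonferroni there are
    few heavy strips, up to slight fattening, and two of them either meet in a
    set of diameter at most [t] or are contained in fattenings of each other.
    So outside a union of few sets of diameter [t], all the heavy strips
    through [x] lie in a single strip [V] of width [t^4]. Along the scales
    [t_(k+1) = t_k^2] these exceptional sets are summably small in the sense of
    the [s]-dimensional Hausdorff measure. For any other [x], the strip
    [V_(k+1)] is contained in [V_k] or has mass at most [t_k^(s/4)], so the
    union of the [V_k] has small mass. A cover of [pi_x(K \ {x})] by arcs of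
    small total [s/64]-power then pulls back to light strips of small total
    mass and to heavy ones inside that union, which is not enough to cover [K].

    Only finite additivity of [mu] is needed, so [mu] is defined on all subsets
    of the plane, as an ultrafilter limit of measures obtained by distributing
    a dyadic content down the tree of dyadic squares. That the content can be
    approximated from inside by compact sets follows from its continuity along
    increasing sequences and from the representation of Borel sets by Souslin
    schemes. *)

Require Import Defs.
From mathcomp Require Import all_boot all_order all_algebra.
From mathcomp Require Import all_classical all_reals all_analysis.
From mathcomp Require Import ring lra zify.
Set Implicit Arguments.
Unset Strict Implicit.
Unset Printing Implicit Defensive.
Import Order.TTheory GRing.Theory Num.Theory.
Import numFieldNormedType.Exports.
Local Open Scope classical_set_scope.
Local Open Scope ring_scope.

(** * Null sets of Hausdorff measures *)

Lemma partial_sum_le {R : realType} (u : nat -> R) (e : R) n :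
  (forall k, 0 <= u k) -> (\sum_(k <oo) (u k)%:E <= e%:E)%E ->
  \sum_(k < n) u k <= e.
Proof.
move=> u0 ue; rewrite -lee_fin -sumEFin -(big_mkord xpredT (fun k => (u k)%:E)).
apply: le_trans ue; apply: nneseries_lim_ge => k _ _; rewrite lee_fin; exact: u0.
Qed.

Section NullSets.
Context {R : realType} {n : nat}.
Implicit Types (A B : set 'rV[R]_n) (s t e : R).

Definition spread_le A (d : R) : Prop :=
  forall p q, A p -> A q -> enorm (p - q) <= d.

(** Nullity for the [s]-dimensional Hausdorff measure, with real bounds [d k] instead of
    extended-real diameters and no cap on the size of the pieces: for [s > 0] a small sum already
    forces small pieces. *)
Definition cnull s A : Prop := forall e, 0 < e ->
  exists (F : nat -> set 'rV[R]_n) (d : nat -> R),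
    [/\ A `<=` \bigcup_k F k, forall k, 0 <= d k,
        forall k, spread_le (F k) (d k) &
        (\sum_(k <oo) (d k `^ s)%:E <= e%:E)%E].

Lemma diam_ge0 A : (0 <= diam A)%E.
Proof. by apply: ereal_sup_ubound; left. Qed.

Lemma diam_leP A d : 0 <= d -> (diam A <= d%:E)%E <-> spread_le A d.
Proof.
move=> d0; split=> [Ad p q Ap Aq|Ad].
  rewrite -lee_fin; apply: le_trans Ad; apply: ereal_sup_ubound; right.
  by exists (p, q).
apply: ge_ereal_sup => _ [->|[[p q] [/= Ap Aq] <-]]; rewrite lee_fin//.
exact: Ad.
Qed.

Lemma diam_pow_le s A d : 0 < s -> 0 <= d -> spread_le A d ->
  (diam_pow s A <= (d `^ s)%:E)%E.
Proof.
move=> s0 d0 Ad; rewrite /diam_pow; case: ifP => _; first by rewrite lee_fin powR_ge0.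
rewrite -poweR_EFin; apply: gt0_ler_poweR; rewrite ?(ltW s0)//.
- by rewrite in_itv/= diam_ge0 leey.
- by rewrite in_itv/= lee_fin d0 leey.
- exact/(diam_leP A d0).
Qed.

Lemma diam_pow_ge0 s A : (0 <= diam_pow s A)%E.
Proof. by rewrite /diam_pow; case: ifP => // _; exact: poweR_ge0. Qed.

Lemma cnull_hausdorff s A : 0 < s -> cnull s A -> hausdorff_measure s A = 0%E.
Proof.
move=> s0 nA; apply/eqP; rewrite eq_le; apply/andP; split; last first.
  apply: (@le_trans _ _ (hausdorff_premeasure s 1 A)); last first.
    by apply: ereal_sup_ubound; exists 1 => //=.
  apply: le_ereal_inf_tmp => _ [F _ <-]; apply: nneseries_ge0 => k _ _.
  exact: diam_pow_ge0.
apply: ge_ereal_sup => _ [delta /= delta0 <-]; apply/lee_addgt0Pr => e e0.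
rewrite add0e.
(* A total of at most delta^s bounds each term, so every [d k] is at most [delta]. *)
have m0 : 0 < Num.min e (delta `^ s) by rewrite lt_min e0 powR_gt0.
have [F [d [AF d0 Fd dm]]] := nA _ m0.
have dk k : d k <= delta.
  rewrite leNgt; apply/negP => dk.
  have := partial_sum_le k.+1 (fun i => powR_ge0 (d i) s) dm.
  rewrite big_ord_recr/= => /(le_trans _) => /(_ (d k `^ s)).
  rewrite lerDr sumr_ge0// => [/(_ isT)|i _]; last exact: powR_ge0.
  rewrite le_min => /andP[_]; rewrite leNgt => /negP; apply.
  by apply: gt0_ltr_powR; rewrite ?nnegrE// ltW.
apply: le_trans (_ : (\sum_(k <oo) diam_pow s (F k) <= _)%E).
  apply: ereal_inf_lbound; exists F => //; split => // k.
  apply/(diam_leP (F k) (ltW delta0)).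
  by move=> p q Fp Fq; exact: le_trans (Fd k _ _ Fp Fq) (dk k).
apply: le_trans (_ : (\sum_(k <oo) (d k `^ s)%:E <= _)%E).
  by apply: lee_nneseries => k _ *; [exact: diam_pow_ge0|exact: diam_pow_le].
by apply: le_trans dm _; rewrite lee_fin ge_min lexx.
Qed.

Lemma hausdorff_cnull s t A : 0 <= s -> s <= t -> 0 < t ->
  hausdorff_measure s A = 0%E -> cnull t A.
Proof.
move=> s0 st t0 H e e0.
have P1 : (hausdorff_premeasure s 1 A < e%:E)%E.
  apply: le_lt_trans (_ : 0 < _)%E; last by rewrite lte_fin.
  by rewrite -H; apply: ereal_sup_ubound; exists 1 => //=.
have [_ [F [AF F1] <-] Fe] := ereal_inf_lt P1.
have Ffin k : diam (F k) \is a fin_num.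
  by rewrite ge0_fin_numE ?diam_ge0// (le_lt_trans (F1 k)) ?ltry.
exists F, (fun k => fine (diam (F k))); split => //.
- by move=> k; rewrite fine_ge0// diam_ge0.
- move=> k; apply/(diam_leP (F k)); first by rewrite fine_ge0// diam_ge0.
  by rewrite fineK.
apply: le_trans (ltW Fe); apply: lee_nneseries => k _ *.
  by rewrite lee_fin powR_ge0.
rewrite /diam_pow; case: ifPn => [/eqP ->|F0].
  have -> : diam (set0 : set 'rV[R]_n) = 0%E.
    apply/eqP; rewrite eq_le diam_ge0 andbT; apply: ge_ereal_sup.
    by move=> _ [->//|[pq [[]]]].
  by rewrite fine0 powR0 ?gt_eqF.
rewrite -{2}(fineK (Ffin k)) poweR_EFin lee_fin.
have := fine_ge0 (diam_ge0 (F k)); rewrite le_eqVlt => /predU1P[<-|dp].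
  by rewrite powR0 ?gt_eqF// powR_ge0.
by apply: ger_powR => //; rewrite dp/= -lee_fin fineK.
Qed.

Lemma hausdorff_dim_eq0P A :
  hausdorff_dim A = 0%E <-> forall s, 0 < s -> cnull s A.
Proof.
split=> [A0 s s0|A0].
  have : (hausdorff_dim A < s%:E)%E by rewrite A0 lte_fin.
  by move=> /ereal_inf_lt[_ [t [t0 Ht] <-]]; rewrite lte_fin => /ltW ts; exact: hausdorff_cnull Ht.
apply/eqP; rewrite eq_le; apply/andP; split; last first.
  by apply: le_ereal_inf_tmp => _ [t [t0 _] <-]; rewrite lee_fin.
apply/lee_addgt0Pr => e e0; rewrite add0e; apply: ereal_inf_lbound.
by exists e => //; split; [exact: ltW|apply: cnull_hausdorff => //; exact: A0].
Qed.

Lemma sub_cnull s A B : A `<=` B -> cnull s B -> cnull s A.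
Proof.
move=> AB nB e /nB[F [d [BF ? ? ?]]]; exists F, d; split => //.
exact: subset_trans BF.
Qed.

Lemma cnull_esum (I : countType) s A : 0 < s ->
  (forall e, 0 < e -> exists (S : set I) (F : I -> set 'rV[R]_n) (d : I -> R),
    [/\ A `<=` \bigcup_(i in S) F i, forall i, 0 <= d i,
        forall i, S i -> spread_le (F i) (d i) &
        (\esum_(i in S) (d i `^ s)%:E <= e%:E)%E]) -> cnull s A.
Proof.
move=> s0 H e e0; have [S [F [d [AF d0 Fd de]]]] := H _ e0.
(* The cover is reindexed along [pickle]; a natural number coding no index in [S] receives the empty
   set with bound 0, which costs nothing as [s > 0]. *)
pose un m := if pickle_inv m is Some i then if i \in S then Some i else None else None.
pose G m := if un m is Some i then F i else set0.
pose g m := if un m is Some i then d i else 0.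
have unP i : S i -> un (pickle i) = Some i by move=> Si; rewrite /un pickleK_inv mem_set.
have unS m i : un m = Some i -> S i.
  by rewrite /un; case: pickle_inv => // j; case: ifPn => // /set_mem Sj [<-].
exists G, g; split.
- by move=> x /AF[i Si Fi]; exists (pickle i) => //; rewrite /G unP.
- by move=> m; rewrite /g; case: (un m).
- move=> m; rewrite /G /g; case E : (un m) => [i|]; last by move=> ? ? [].
  exact: (Fd i (unS m i E)).
rewrite nneseries_esumT; last by move=> k; rewrite lee_fin powR_ge0.
apply: le_trans de.
rewrite (_ : esum S _ = \esum_(i in S) (fun m => (g m `^ s)%:E) (pickle i)); last first.
  by apply: eq_esum => i Si; rewrite /g unP.
rewrite -(esum_image S pickle (fun m => (g m `^ s)%:E)); last first.
  by move=> i j _ _; exact: (pcan_inj pickleK).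
rewrite [leRHS]esum_mkcond; apply: le_esum => m _; case: ifPn => // /negP mS.
rewrite /g; case E : (un m) => [i|]; last by rewrite powR0 ?gt_eqF.
exfalso; apply: mS; rewrite inE; exists i; first exact: unS E.
have := @pickle_invK I m; move: E; rewrite /un.
by case: (pickle_inv m) => [j|//] /=; case: ifP => // _ [<-].
Qed.

Lemma bigcup_cnull s (A : nat -> set 'rV[R]_n) : 0 < s ->
  (forall i, cnull s (A i)) -> cnull s (\bigcup_i A i).
Proof.
move=> s0 nA; apply: (@cnull_esum (nat * nat)%type) => // e e0.
have ei i : 0 < e / (2 ^ i.+1)%:R by rewrite divr_gt0// ltr0n expn_gt0.
have /choice[F /choice[d Fd]] i := nA i _ (ei i).
exists setT, (fun ij => F ij.1 ij.2), (fun ij => d ij.1 ij.2); split.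
- move=> x [i _ Aix]; have [AF _ _ _] := Fd i.
  by have [j _ Fij] := AF _ Aix; exists (i, j).
- by move=> ij; have [_ + _ _] := Fd ij.1; apply.
- by move=> ij _; have [_ _ + _] := Fd ij.1; apply.
rewrite (_ : setT = setT `*`` fun=> setT); last by apply/seteqP; split.
rewrite -(@esum_esum _ _ _ setT (fun=> setT) (fun i j => (d i j `^ s)%:E)); last first.
  by move=> *; rewrite lee_fin powR_ge0.
apply: le_trans (epsilon_trick0 (fun=> true) (ltW e0)).
rewrite nneseries_esumT; last by move=> i; rewrite lee_fin ltW.
apply: le_esum => i _; have [_ _ _] := Fd i; apply: le_trans.
by rewrite nneseries_esumT// => j; rewrite lee_fin powR_ge0.
Qed.

End NullSets.

(** * Contents on a tree *)

Section TreeContent.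
Context {R : realType} {X : Type} {T : countType}.
Variables (c : nat -> X -> T) (w : nat -> R).
Hypothesis w_ge0 : forall k, 0 <= w k.
Hypothesis nest : forall k x y, c k.+1 x = c k.+1 y -> c k x = c k y.
Implicit Types (A B : set X) (C D : set (nat * T)).

(** A pair [(k, t)] names the cell of level [k] on which [c k] equals [t]. Cells of all levels may
    be mixed in a cover, so [content] is a Hausdorff content on the tree. *)
Definition covers C A := forall x, A x -> exists k, C (k, c k x).

Definition cost C : \bar R := (\esum_(Q in C) (w Q.1)%:E)%E.

Definition content A : \bar R := ereal_inf [set cost C | C in covers ^~ A].

Lemma nest_le k l x y : (k <= l)%N -> c l x = c l y -> c k x = c k y.
Proof.
elim: l => [|l IH]; first by rewrite leqn0 => /eqP ->.
by rewrite leq_eqVlt => /predU1P[->//|kl /nest]; exact: IH.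
Qed.

Lemma cost_ge0 C : (0 <= cost C)%E.
Proof. by apply: esum_ge0 => Q _; rewrite lee_fin. Qed.

Lemma content_ge0 A : (0 <= content A)%E.
Proof. by apply: le_ereal_inf_tmp => _ [C _ <-]; exact: cost_ge0. Qed.

Lemma content_le C A : covers C A -> (content A <= cost C)%E.
Proof. by move=> CA; apply: ereal_inf_lbound; exists C. Qed.

Lemma le_content A B : A `<=` B -> (content A <= content B)%E.
Proof.
move=> AB; apply: ereal_inf_le_tmp => _ [C CB <-].
by exists C => // x /AB /CB.
Qed.

Lemma le_cost C D : C `<=` D -> (cost C <= cost D)%E.
Proof.
move=> CD; rewrite /cost esum_mkcond [leRHS]esum_mkcond; apply: le_esum => Q _.
case: ifPn => [/set_mem/CD/mem_set ->//|_]; case: ifPn => // _.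
by rewrite lee_fin.
Qed.

Lemma costU C D : (cost (C `|` D) <= cost C + cost D)%E.
Proof.
rewrite {1}/cost (esumID C); last by move=> *; rewrite lee_fin.
apply: leeD; apply: le_cost; first by move=> Q [].
by move=> Q [[|]].
Qed.

Lemma costU_disj C D : C `&` D `<=` set0 -> (cost (C `|` D) = cost C + cost D)%E.
Proof.
move=> CD; rewrite {1}/cost (esumID C); last by move=> *; rewrite lee_fin.
rewrite (_ : (C `|` D) `&` C = C); last first.
  by apply/seteqP; split=> Q; [case|move=> CQ; split; [left|]].
rewrite (_ : (C `|` D) `&` ~` C = D)//; apply/seteqP; split=> Q; first by case=> -[].
by move=> DQ; split; [right|move=> CQ; exact: (CD Q)].
Qed.

Lemma content_lt A e : (content A < e)%E -> exists2 C, covers C A & (cost C < e)%E.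
Proof. by move=> /ereal_inf_lt[_ [C CA <-] Ce]; exists C. Qed.

Lemma contentU A B : (content (A `|` B) <= content A + content B)%E.
Proof.
have := content_ge0 B; have := content_ge0 A.
case EA : (content A) => [a||]// _; last first.
  by move=> B0; rewrite addye ?leey//; case: (content B) B0.
case EB : (content B) => [b||]// _; last by rewrite addey// leey.
apply/lee_addgt0Pr => e e0.
have e20 : 0 < e / 2 by rewrite divr_gt0.
have [C CA Ca] : exists2 C, covers C A & (cost C < (a + e / 2)%:E)%E.
  by apply: content_lt; rewrite EA lte_fin ltrDl.
have [D DB Db] : exists2 D, covers D B & (cost D < (b + e / 2)%:E)%E.
  by apply: content_lt; rewrite EB lte_fin ltrDl.
apply: (@le_trans _ _ (cost (C `|` D))).
  apply: content_le => x [/CA[k ?]|/DB[k ?]]; exists k; [by left|by right].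
apply: le_trans (costU _ _) _; apply: le_trans (leeD (ltW Ca) (ltW Db)) _.
by rewrite -!EFinD lee_fin; lra.
Qed.

Lemma content_cell A k t : (forall x, A x -> c k x = t) -> (content A <= (w k)%:E)%E.
Proof.
move=> At; apply: (@le_trans _ _ (cost [set (k, t)])).
  by apply: content_le => x /At <-; exists k.
by rewrite /cost esum_set1// lee_fin.
Qed.

(* Among the cells of near-optimal covers [C n] of the [A n], keep the maximal
   ones, and let [D n] be those which appear first in [C n]. By near-optimality
   of [C n], exchanging the cells of [C N] below [D n] for [D n] itself costs at
   most the error of [C n], for every [n <= N]. *)
Lemma content_bigcup (A : nat -> set X) (a : R) :
  (forall n m, (n <= m)%N -> A n `<=` A m) ->
  (forall n, (content (A n) <= a%:E)%E) -> (content (\bigcup_n A n) <= a%:E)%E.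
Proof.
move=> Am Aa; apply/lee_addgt0Pr => e e0.
pose en n : R := e / (2 ^ n.+1)%:R.
have en0 n : 0 < en n by rewrite divr_gt0// ltr0n expn_gt0.
have Afin n : content (A n) \is a fin_num.
  by rewrite ge0_fin_numE ?content_ge0// (le_lt_trans (Aa n)) ?ltry.
have /choice[C HC] n : exists C, covers C (A n) /\ (cost C < content (A n) + (en n)%:E)%E.
  have [|C ? ?] := @content_lt (A n) (content (A n) + (en n)%:E); last by exists C.
  by rewrite lteDl// lte_fin.
have Ccov n : covers (C n) (A n) by have [] := HC n.
have Ccost n : (cost (C n) <= content (A n) + (en n)%:E)%E by apply: ltW; have [] := HC n.
pose U Q := exists n, C n Q.
pose D n (Q : nat * T) := [/\ C n Q, forall m, (m < n)%N -> ~ C m Q &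
  forall x k, c Q.1 x = Q.2 -> (k < Q.1)%N -> ~ U (k, c k x)].
pose S n x := exists k, D n (k, c k x).
pose E N n (Q : nat * T) := C N Q /\
  exists x k, [/\ c Q.1 x = Q.2, D n (k, c k x) & (k <= Q.1)%N].
have DC n : D n `<=` C n by move=> Q [].
(* The points of [A n] outside [S n] are covered by the rest of [C n], of cost [r]; near-optimality
   of [C n] then lets the finite number [r] cancel. *)
have costD n : (cost (D n) <= content (A n `&` S n) + (en n)%:E)%E.
  set r := cost (C n `&` ~` D n).
  have Cr : (cost (C n) = cost (D n) + r)%E.
    rewrite {1}/cost (esumID (D n)); last by move=> *; rewrite lee_fin.
    by rewrite (setIidr (@DC n)).
  have rfin : r \is a fin_num.
    rewrite ge0_fin_numE ?cost_ge0//.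
    apply: (@le_lt_trans _ _ (cost (C n))); first by apply: le_cost => Q [].
    apply: le_lt_trans (Ccost n) _.
    by rewrite -(fineK (Afin n)) -EFinD ltry.
  have Ar : (content (A n) <= content (A n `&` S n) + r)%E.
    apply: (@le_trans _ _ (content ((A n `&` S n) `|` (A n `&` ~` S n)))).
      by rewrite -setIUr setUv setIT.
    apply: le_trans (contentU _ _) _; apply: leeD => //; apply: content_le => x [Ax Sx].
    have [k Ck] := Ccov _ _ Ax; exists k; split=> // Dk; apply: Sx; by exists k.
  rewrite -(leeD2rE _ _ rfin) -Cr; apply: le_trans (Ccost n) _.
  rewrite addeAC leeD2r//.
have costE n N : (n <= N)%N -> (content (A n `&` S n) <= cost (E N n))%E.
  move=> nN; apply: content_le => x [Ax [k Dk]].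
  have [k' Ck'] := Ccov _ _ (Am _ _ nN _ Ax).
  exists k'; split=> //; exists x, k; split => //=; rewrite leqNgt; apply/negP => kk'.
  by have [_ _ /(_ x k' erefl kk')] := Dk; apply; exists N.
(* The families [E N n] are disjoint for distinct [n]: a common cell would lie below cells of [D n]
   and [D M], which coincide by maximality, against first appearance. *)
have sumE N M : (M <= N)%N -> (\sum_(0 <= n < M) cost (E N n) <=
    cost (C N `&` [set Q | exists n, (n < M)%N /\ E N n Q]))%E.
  elim: M => [|M IH] MN; first by rewrite big_geq// cost_ge0.
  rewrite big_nat_recr//=; apply: le_trans (leeD (IH (ltnW MN)) (lexx _)) _.
  rewrite -costU_disj; last first.
    move=> [l t] [[_ [n [nM [_ [x [k [/= xt Dx kl]]]]]]] [_ [y [k' [/= yt Dy kl']]]]].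
    have xy : c l x = c l y by rewrite xt.
    have [kk|kk|kk] := ltngtP k k'.
    - have [_ _ /(_ x k)] := Dy; rewrite (nest_le kl' xy) => /(_ erefl kk); apply.
      by exists n; have [] := Dx.
    - have [_ _ /(_ y k')] := Dx; rewrite (nest_le kl xy) => /(_ erefl kk); apply.
      by exists M; have [] := Dy.
    - move: Dy; rewrite -kk -(nest_le kl xy) => -[_ /(_ n nM) + _]; apply.
      by have [] := Dx.
  apply: le_cost => Q [[CQ [n [nM EQ]]]|EQ].
    by split=> //; exists n; split=> //; exact: leqW.
  by split; [case: EQ|exists M].
have tD : trivIset setT D.
  move=> n m _ _ [Q [[Cn Ln _] [Cm Lm _]]].
  have [nm|mn|//] := ltngtP n m; first by have := Lm _ nm Cn.
  by have := Ln _ mn Cm.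
apply: (@le_trans _ _ (cost (\bigcup_n D n))).
  (* The least level at which the cell of [x] belongs to some cover, and then the first such cover,
     give a cell of some [D m]. *)
  apply: content_le => x [n _ Ax].
  have [k0 Ck0] := Ccov _ _ Ax.
  have exk : exists k, `[< U (k, c k x) >] by exists k0; apply/asboolP; exists n.
  case: (ex_minnP exk) => k /asboolP[m Cm] kmin.
  have exm : exists m, `[< C m (k, c k x) >] by exists m; apply/asboolP.
  case: (ex_minnP exm) => {Cm}m /asboolP Cm mmin.
  exists k, m => //; split => //=.
    by move=> m' m'm Cm'; have := mmin m' (asboolT Cm'); rewrite leqNgt m'm.
  move=> y k' yx k'k; rewrite (nest_le (ltnW k'k) yx) => Uk'.
  by have := kmin k' (asboolT Uk'); rewrite leqNgt k'k.
rewrite /cost nneseries_sum_bigcup//; last by move=> Q; rewrite lee_fin.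
apply: lime_le; first by apply: is_cvg_nneseries => n _ _; exact: cost_ge0.
apply: nearW => N /=.
apply: (@le_trans _ _ (\sum_(0 <= n < N) (cost (E N n) + (en n)%:E))%E).
  rewrite !big_nat; apply: lee_sum => n /andP[_ nN].
  by apply: le_trans (costD n) _; rewrite leeD2r// costE// ltnW.
rewrite big_split/=; apply: le_trans (leeD (sumE _ _ (leqnn N)) (lexx _)) _.
apply: le_trans (leeD (le_cost (@subIsetl _ _ _)) (lexx _)) _.
apply: le_trans (leeD (Ccost N) (lexx _)) _; rewrite -addeA; apply: leeD => //.
rewrite addeC -(@big_nat_recr _ _ _ _ _ (fun n => (en n)%:E))//=.
apply: le_trans (epsilon_trick0 xpredT (ltW e0)).
by apply: nneseries_lim_ge => n _ _; rewrite lee_fin ltW.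
Qed.

End TreeContent.

(** * Finitely additive Frostman measures on a tree *)

Section FinitelyAdditive.
Context {R : realType} {X : Type}.
Implicit Types (m : set X -> R) (S : set X).

Definition fadd m : Prop :=
  (forall S, 0 <= m S) /\
  forall S S', S `&` S' `<=` set0 -> m (S `|` S') = m S + m S'.

Lemma fadd0 m : fadd m -> m set0 = 0.
Proof.
move=> [_ mU]; have := mU set0 set0; rewrite setU0 setI0 => /(_ (@subset_refl _ _)).
lra.
Qed.

Lemma le_fadd m S S' : fadd m -> S `<=` S' -> m S <= m S'.
Proof.
move=> [m0 mU] SS'; rewrite -(setDUK SS') mU ?lerDl// => x [? []//].
Qed.

Lemma faddC m S : fadd m -> m (~` S) = m setT - m S.
Proof.
by move=> [m0 mU]; rewrite -(setUv S) mU ?setICr// addrC addKr.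
Qed.

Lemma faddU m S S' : fadd m -> m (S `|` S') = m S + m S' - m (S `&` S').
Proof.
move=> [m0 mU]; have -> : m S' = m (S `&` S') + m (S' `\` S).
  by rewrite setIC -mU ?setUIDK// => x [[? ?] []].
rewrite (_ : S `|` S' = S `|` (S' `\` S)); last first.
  apply/seteqP; split=> x; first by case: (pselect (S x)); [left|move=> ? []; [|right]].
  by case=> [|[]]; [left|right].
rewrite mU; last by move=> x [? []].
lra.
Qed.

Lemma faddU_le m S S' : fadd m -> m (S `|` S') <= m S + m S'.
Proof. by move=> fm; rewrite faddU// gerBl; case: fm. Qed.

Lemma fadd_bigcup_le m n (S : nat -> set X) : fadd m ->
  m [set x | exists2 k, (k < n)%N & S k x] <= \sum_(k < n) m (S k).
Proof.
move=> fm; elim: n => [|n IH].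
  rewrite big_ord0 -(fadd0 fm); apply: le_fadd => // x [k].
  by rewrite ltn0.
rewrite big_ord_recr/=; apply: le_trans (lerD IH (lexx _)).
apply: le_trans (faddU_le _ _ fm); apply: le_fadd => // x [k].
by rewrite ltnS leq_eqVlt => /predU1P[->|kn Skx]; [right|left; exists k].
Qed.

End FinitelyAdditive.

(** * Distributing a content down a finitely branching tree *)

Section TreeFrostman.
Context {R : realType} {X : Type} {T : countType} {B : finType}.
Variables (c : nat -> X -> T) (w : nat -> R) (b : nat -> X -> B).
Hypothesis w_ge0 : forall k, 0 <= w k.
Hypothesis nest : forall k x y,
  c k.+1 x = c k.+1 y <-> c k x = c k y /\ b k x = b k y.
Implicit Types A : set X.

Lemma content_bigU (r : seq B) (F : B -> set X) :
  (content c w (\big[setU/set0]_(v <- r) F v) <= \sum_(v <- r) content c w (F v))%E.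
Proof.
elim: r => [|v r IH]; last first.
  by rewrite !big_cons; apply: le_trans (contentU c w_ge0 _ _) _ => //; exact: leeD.
rewrite !big_nil; apply: (@le_trans _ _ (cost w (set0 : set (nat * T)))).
  by apply: content_le => x [].
by rewrite /cost esum_set0.
Qed.

Lemma content_fin A k t : (forall x, A x -> c k x = t) ->
  content c w A \is a fin_num.
Proof.
move=> At; rewrite ge0_fin_numE ?content_ge0//.
by apply: le_lt_trans (content_cell w_ge0 At) _; rewrite ltry.
Qed.

(* The mass [content A] is distributed downwards, at each node proportionally
   to the contents of the children; by subadditivity of the content, the
   proportionality factor is at most 1. *)
Lemma tree_frostman n k t A : (forall x, A x -> c k x = t) ->
  exists m : set X -> R, [/\ fadd m, m setT = fine (content c w A), m (~` A) = 0 &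
    forall l y, (k <= l <= k + n)%N -> m [set x | c l x = c l y] <= w l].
Proof.
elim: n k t A => [|n IH] k t A At; have Af := content_fin At.
  have Aw : fine (content c w A) <= w k.
    by rewrite -lee_fin fineK//; exact: content_cell At.
  have A0 : 0 <= fine (content c w A) by rewrite fine_ge0// content_ge0.
  have [->|/set0P[p Ap]] := eqVneq A set0.
    have c0 : content c w (set0 : set X) = 0%E.
      apply/eqP; rewrite eq_le content_ge0// andbT.
      by have := content_bigU [::] (fun=> set0); rewrite !big_nil.
    exists (fun=> 0); split=> //; first by split=> // *; rewrite addr0.
    by rewrite c0.
  (* Only level [k] is constrained here, so all the mass may sit at one point [p]. *)
  exists (fun S => if p \in S then fine (content c w A) else 0); split.
  - split=> [S|S S' SS']; first by case: ifP.
    rewrite in_setU; have [pS|_] := boolP (p \in S); last by rewrite add0r.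
    have [pS'|_] := boolP (p \in S'); last by rewrite addr0.
    by have := SS' p (conj (set_mem pS) (set_mem pS')).
  - by rewrite in_setT.
  - by case: ifPn => // /set_mem.
  - move=> l y; rewrite addn0 -eqn_leq => /eqP <-.
    by case: ifP => // _; exact: w_ge0.
pose Av v := A `&` [set x | b k x = v].
have /choice[m Hm] v : exists m : set X -> R, [/\ fadd m,
    m setT = fine (content c w (Av v)), m (~` Av v) = 0 &
    forall l y, (k.+1 <= l <= k.+1 + n)%N -> m [set x | c l x = c l y] <= w l].
  have [[y Ay]|nA] := pselect (exists x, Av v x).
    apply: (IH k.+1 (c k.+1 y)) => x [Ax bx]; apply/nest.
    by case: Ay => /= Ay ->; rewrite bx !At.
  by apply: (IH k.+1 t) => x Ax; case: nA; exists x.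
pose s := \sum_v fine (content c w (Av v)).
have Avf v : content c w (Av v) \is a fin_num.
  by apply: (@content_fin _ k t) => x [/At].
have As : fine (content c w A) <= s.
  rewrite -lee_fin fineK// /s -sumEFin; under eq_bigr do rewrite fineK//.
  apply: le_trans (content_bigU _ _); apply: le_content => x Ax.
  by rewrite -bigcup_seq; exists (b k x) => //=; rewrite mem_index_enum.
have A0 : 0 <= fine (content c w A) by rewrite fine_ge0// content_ge0.
(* If [s = 0], division by zero gives [la = 0], which is right because the content of [A] is then 0
   as well. *)
pose la := fine (content c w A) / s.
have s0 : 0 <= s by rewrite sumr_ge0// => v _; rewrite fine_ge0// content_ge0.
have la0 : 0 <= la by rewrite divr_ge0.
have la1 : la <= 1.
  have [sp|sn] := ltP 0 s; first by rewrite ler_pdivrMr// mul1r.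
  by rewrite /la (_ : s = 0) ?invr0 ?mulr0//; apply/eqP; rewrite eq_le sn s0.
have las : la * s = fine (content c w A).
  have [sp|sn] := ltP 0 s; first by rewrite divfK// gt_eqF.
  have sz : s = 0 by apply/eqP; rewrite eq_le sn s0.
  by rewrite sz mulr0; apply/eqP; rewrite eq_le A0 -sz As.
have fm : fadd (fun S => la * \sum_v m v S).
  split=> [S|S S' SS'].
    by rewrite mulr_ge0// sumr_ge0// => v _; have [[]] := Hm v.
  rewrite -mulrDr -big_split/=; congr (_ * _); apply: eq_bigr => v _.
  by have [[_ mU] _ _ _] := Hm v; exact: mU.
exists (fun S => la * \sum_v m v S).
have mT : la * (\sum_v m v setT) = fine (content c w A).
  by rewrite -las; congr (_ * _); apply: eq_bigr => v _; have [_ ->] := Hm v.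
split=> //.
  rewrite big1 ?mulr0// => v _; have [fv _ mv _] := Hm v.
  apply/eqP; rewrite eq_le; case: (fv) => -> _; rewrite andbT -mv.
  by apply: le_fadd => // x Ax [].
move=> l y /andP[]; rewrite leq_eqVlt => /predU1P[<- _|kl ln].
  apply: (@le_trans _ _ (la * (\sum_v m v setT))).
    exact: (le_fadd fm).
  by rewrite mT -lee_fin fineK//; exact: content_cell At.
apply: (@le_trans _ _ (\sum_v m v [set x | c l x = c l y])).
  rewrite ler_piMl// sumr_ge0// => v _; by have [[]] := Hm v.
(* A cell deeper than level [k] lies below a single child; the measures of the other children vanish
   on it. *)
rewrite (bigD1 (b k y))//= [X in _ + X]big1 ?addr0.
  by have [_ _ _ ->//] := Hm (b k y); rewrite kl addSnnS.
move=> v vy; have [fv _ mv _] := Hm v.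
apply/eqP; rewrite eq_le; case: (fv) => -> _; rewrite andbT -mv.
apply: le_fadd => // x /= xy [_ /= bx].
have /nest[_ bxy] : c k.+1 x = c k.+1 y.
  by apply: nest_le kl xy => j p q /nest[].
by move: vy; rewrite -bx bxy eqxx.
Qed.

End TreeFrostman.

(** * Dyadic squares *)

Section Plane.
Context {R : realType}.
Implicit Types (x y p q : 'rV[R]_2) (r s : R).

Lemma enorm2E x : enorm x = Num.sqrt (x 0 0 ^+ 2 + x 0 1 ^+ 2).
Proof.
by rewrite /enorm big_ord_recl big_ord1; congr (Num.sqrt (_ + x 0 _ ^+ 2)); exact: val_inj.
Qed.

Lemma sqr_enorm2 x : enorm x ^+ 2 = x 0 0 ^+ 2 + x 0 1 ^+ 2.
Proof. by rewrite enorm2E sqr_sqrtr// addr_ge0// sqr_ge0. Qed.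

Lemma enorm_ge0 n (x : 'rV[R]_n) : 0 <= enorm x.
Proof. exact: sqrtr_ge0. Qed.

Lemma enorm_le_coord x r : `|x 0 0| <= r -> `|x 0 1| <= r -> enorm x <= 2 * r.
Proof.
move=> x0 x1; have r0 : 0 <= r by exact: le_trans x0.
rewrite -(@ler_pXn2r _ 2)// ?nnegrE ?enorm_ge0 ?mulr_ge0//.
rewrite sqr_enorm2 exprMn -(real_normK (num_real (x 0 0))) -(real_normK (num_real (x 0 1))).
have := normr_ge0 (x 0 0); have := normr_ge0 (x 0 1); nra.
Qed.

Lemma coord_le_enorm x i : `|x 0 i| <= enorm x.
Proof.
rewrite -(@ler_pXn2r _ 2)// ?nnegrE ?enorm_ge0//.
rewrite sqr_enorm2 real_normK ?num_real//.
by case: i => [[|[|//]] i2]; [rewrite (_ : Ordinal i2 = 0)|rewrite (_ : Ordinal i2 = 1)];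
  rewrite ?lerDl ?lerDr ?sqr_ge0//; exact: val_inj.
Qed.

Definition sq p r : set 'rV[R]_2 :=
  [set y | `|y 0 0 - p 0 0| <= r /\ `|y 0 1 - p 0 1| <= r].

Definition fl k (z : R) : int := Num.floor (2 ^+ k * z).

Definition dyad k x : int * int := (fl k (x 0 0), fl k (x 0 1)).

(** The next binary digit. A dyadic square is determined by its parent and two such digits, which
    makes the tree branch over the finite type [bool * bool]. *)
Definition bit k (z : R) : bool := fl k.+1 z == 2 * fl k z + 1.

Definition dbit k x : bool * bool := (bit k (x 0 0), bit k (x 0 1)).

Lemma flS k z : fl k.+1 z = 2 * fl k z + (bit k z)%:Z.
Proof.
rewrite /bit; case: eqP => [->//|]; rewrite addr0.
have := floor_itv (2 ^+ k.+1 * z); have := floor_itv (2 ^+ k * z).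
rewrite -/(fl k z) -/(fl k.+1 z) exprS.
move: (fl k z) (fl k.+1 z) => g f; set u := 2 ^+ k * z.
rewrite -mulrA -/u => /andP[g1 g2] /andP[f1 f2] fg.
have : f < 2 * g + 2 by rewrite -(@ltr_int R) !intrD intrM/=; move: g2; rewrite !intrD/=; lra.
have : 2 * g < f + 1 by rewrite -(@ltr_int R) !intrD intrM/=; move: f2; rewrite !intrD/=; lra.
lia.
Qed.

Lemma dyad_nest k x y :
  dyad k.+1 x = dyad k.+1 y <-> dyad k x = dyad k y /\ dbit k x = dbit k y.
Proof.
have fl_nest z t : fl k.+1 z = fl k.+1 t <-> fl k z = fl k t /\ bit k z = bit k t.
  split; last by rewrite !flS => -[-> ->].
  by rewrite !flS; case: (bit k z); case: (bit k t) => /= H; split=> //; lia.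
rewrite /dyad /dbit; split.
  by move=> [/fl_nest[-> ->] /fl_nest[-> ->]].
by move=> [[a b] [c d]]; congr (_, _); apply/fl_nest.
Qed.

Lemma fl_close k z t : fl k z = fl k t -> `|z - t| <= 2 ^- k.
Proof.
move=> zt; have := floor_itv (2 ^+ k * z); have := floor_itv (2 ^+ k * t).
rewrite -/(fl k z) -/(fl k t) zt intrD/= => /andP[a b] /andP[c d].
rewrite -[leRHS]mul1r ler_pdivlMr ?exprn_gt0// -[X in _ * X]gtr0_norm ?exprn_gt0//.
rewrite -normrM ler_norml; apply/andP; split; lra.
Qed.

Lemma fl_near k z t : `|z - t| <= 2 ^- k -> `|fl k z - fl k t| <= 1.
Proof.
rewrite -[leRHS]mul1r ler_pdivlMr ?exprn_gt0// -[X in _ * X]gtr0_norm ?exprn_gt0//.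
rewrite -normrM ler_norml mulrBl !(mulrC _ (2 ^+ k)) => /andP[z1 z2].
have := floor_itv (2 ^+ k * z); have := floor_itv (2 ^+ k * t).
rewrite -/(fl k z) -/(fl k t) !intrD/= => /andP[a b] /andP[c d].
have : fl k z < fl k t + 2 by rewrite -(@ltr_int R) !intrD/=; lra.
have : fl k t < fl k z + 2 by rewrite -(@ltr_int R) !intrD/=; lra.
lia.
Qed.

Lemma dyad_spread k x : spread_le [set y | dyad k y = dyad k x] (2 * 2 ^- k).
Proof.
move=> p q /= [p0 p1] [q0 q1]; apply: enorm_le_coord.
  by rewrite !mxE; apply: fl_close; rewrite p0.
by rewrite !mxE; apply: fl_close; rewrite p1.
Qed.

Definition dcost s k : R := (2 * 2 ^- k) `^ s.

Lemma dcost_ge0 s k : 0 <= dcost s k.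
Proof. exact: powR_ge0. Qed.

Lemma content0_cnull s (A : set 'rV[R]_2) : 0 < s ->
  content dyad (dcost s) A = 0%E -> cnull s A.
Proof.
move=> s0 A0; apply: (@cnull_esum _ _ (nat * (int * int))%type) => // e e0.
have [C CA Ce] : exists2 C, covers dyad C A & (cost (dcost s) C < e%:E)%E.
  by apply: content_lt; rewrite A0 lte_fin.
exists C, (fun Q => [set x | dyad Q.1 x = Q.2]), (fun Q => 2 * 2 ^- Q.1); split.
- by move=> x /CA[k Ck]; exists (k, dyad k x).
- by move=> Q; rewrite mulr_ge0// invr_ge0 exprn_ge0.
- by move=> [k t] _ p q /= pt qt; apply: (dyad_spread (x := q)) => //=; rewrite pt.
- exact: ltW.
Qed.

Lemma dyadic_scale r : 0 < r <= 1 -> exists k, 2 ^- k.+1 < r <= 2 ^- k.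
Proof.
move=> /andP[r0 r1].
have exk : exists k, 2 ^- k.+1 < r.
  exists (Num.bound r^-1); rewrite invf_plt ?posrE ?exprn_gt0//.
  apply: lt_le_trans (archi_boundP _) _; first by rewrite invr_ge0 ltW.
  by rewrite -natrX ler_nat ltnW// (ltn_trans (ltnSn _))// ltn_expl.
case: (ex_minnP exk) => -[rk _|k rk kmin]; first by exists 0%N; rewrite rk expr0 invr1 r1.
exists k.+1; rewrite rk/= leNgt; apply/negP => /kmin.
by rewrite ltnn.
Qed.

(** As [r] is at most 2^-k, the square meets only a 3 by 3 block of dyadic squares of level [k],
    each of mass at most [dcost s k]; since 2^-k is below [2 * r], this is at most (4 r)^s. *)
Lemma square_mass s k n (m : set 'rV[R]_2 -> R) p r : fadd m -> 0 < s -> (k <= n)%N ->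
  (forall l y, (l <= n)%N -> m [set x | dyad l x = dyad l y] <= dcost s l) ->
  2 ^- k.+1 < r <= 2 ^- k -> m (sq p r) <= 9 * (4 * r) `^ s.
Proof.
move=> fm s0 kn mle /andP[r1 r2].
(* The remainder and the quotient of [q] by 3, less 1, are the two offsets within the block. *)
pose Z (q : nat) : set 'rV[R]_2 := [set y | fl k (y 0 0) = fl k (p 0 0) + (q %% 3)%N%:Z - 1 /\
  fl k (y 0 1) = fl k (p 0 1) + (q %/ 3)%N%:Z - 1].
have r0 : 0 < r by apply: lt_trans r1; rewrite invr_gt0 exprn_gt0.
have Zle (q : nat) : m (Z q) <= (4 * r) `^ s.
  have [[y [y0 y1]]|nZ] := pselect (exists y, Z q y); last first.
    by rewrite (_ : Z q = set0) ?fadd0 ?powR_ge0//; apply/seteqP; split=> // y Zy; case: nZ; exists y.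
  rewrite (_ : Z q = [set x | dyad k x = dyad k y]); last first.
    rewrite /Z -y0 -y1; apply/seteqP; split=> x /=; first by rewrite /dyad => -[-> ->].
    by move=> [-> ->].
  apply: le_trans (mle k y kn) _; rewrite /dcost.
  apply: ge0_ler_powR; rewrite ?nnegrE ?(ltW s0) ?mulr_ge0 ?invr_ge0 ?exprn_ge0 ?(ltW r0)//.
  by move: r1; rewrite exprS invfM; lra.
apply: (@le_trans _ _ (\sum_(q < 9) m (Z q))); last first.
  apply: le_trans (ler_sum _ (fun (q : 'I_9) _ => Zle q)) _.
  by rewrite sumr_const card_ord -[leLHS]mulr_natl.
apply: le_trans (fadd_bigcup_le _ _ fm); apply: le_fadd => // y [y0 y1].
have /(fl_near (k := k)) a0 := le_trans y0 r2; have /(fl_near (k := k)) a1 := le_trans y1 r2.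
rewrite /Z/=; set a := fl k (y 0 0) in a0 *; set b := fl k (y 0 1) in a1 *.
move: (fl k (p 0 0)) (fl k (p 0 1)) a0 a1 => a' b' a0 a1.
exists (absz (a - a' + 1)%R + 3 * absz (b - b' + 1)%R)%N; [lia|split; lia].
Qed.

End Plane.

(** * Souslin schemes and capacitability *)

Section Souslin.
Context {T : topologicalType}.
Implicit Types A : set T.

(** A finite sequence is encoded as a length [n] and a total function of which only the first [n]
    values count. *)
Definition souslin_scheme (F : nat -> (nat -> nat) -> set T) : Prop :=
  (forall n f, closed (F n f)) /\
  forall n f g, (forall i, (i < n)%N -> f i = g i) -> F n f = F n g.

Definition souslin A : Prop := exists F, souslin_scheme F /\
  A = [set x | exists f, forall n, F n f x].

Lemma closed_souslin A : closed A -> souslin A.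
Proof.
move=> cA; exists (fun _ _ => A); split=> //; apply/seteqP; split=> x Ax.
  by exists (fun=> 0%N).
by case: Ax => f /(_ 0%N).
Qed.

(** The first value of a branch selects one of the sets, and the shifted branch is a branch for that
    set. *)
Lemma bigcup_souslin (A : nat -> set T) :
  (forall i, souslin (A i)) -> souslin (\bigcup_i A i).
Proof.
move=> /choice[F HF]; have {}HF i := HF i.
have sF i : souslin_scheme (F i) by have [] := HF i.
have AF i : A i = [set x | exists f, forall n, F i n f x] by have [] := HF i.
exists (fun n f => if n is m.+1 then F (f 0%N) m (fun i => f i.+1) else setT).
split.
  split=> [[|n] f|[|n] f g fg]//.
    by have [+ _] := sF (f 0%N); exact.
  rewrite fg//; have [_ H] := sF (g 0%N); apply: H => i ni; exact: fg.
apply/seteqP; split=> x.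
  move=> [i _]; rewrite AF => -[f Ff].
  by exists (fun n => if n is m.+1 then f m else i) => -[|n]//=; exact: Ff.
move=> [f Ff]; exists (f 0%N) => //; rewrite AF; exists (fun i => f i.+1) => n.
exact: (Ff n.+1).
Qed.

(** Through [pickle], one branch [f] codes a branch [sub f i] for every [i]. Level [k] imposes only
    the conditions settled by the values of [f] below [k], which [D k] collects. *)
Lemma bigcap_souslin (A : nat -> set T) :
  (forall i, souslin (A i)) -> souslin (\bigcap_i A i).
Proof.
move=> /choice[F HF]; have {}HF i := HF i.
have sF i : souslin_scheme (F i) by have [] := HF i.
have AF i : A i = [set x | exists f, forall n, F i n f x] by have [] := HF i.
pose D k := [set u : nat * nat | forall m, (m < u.2)%N -> (pickle (u.1, m) < k)%N].
pose sub (f : nat -> nat) (i m : nat) := f (pickle (i, m)).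
exists (fun k f => \bigcap_(u in D k) F u.1 u.2 (sub f u.1)).
split.
  split=> [k f|k f g fg].
    by apply: closed_bigI => u _; have [+ _] := sF u.1; exact.
  apply: eq_bigcapr => u Du; have [_ H] := sF u.1.
  by apply: H => m mu; apply: fg; exact: Du.
apply/seteqP; split=> x.
  move=> Ax; have /choice[f Hf] i : exists f, forall n, F i n f x.
    by have := Ax i Logic.I; rewrite AF.
  exists (fun k => if (unpickle k : option (nat * nat)) is Some u then f u.1 u.2 else 0%N).
  move=> k u _; rewrite (_ : sub _ _ = f u.1); first exact: Hf.
  by apply/funext => m; rewrite /sub pickleK.
move=> [f Ff] i _; rewrite AF; exists (sub f i) => n.
apply: (Ff (\max_(m < n) (pickle (i, m : nat))).+1 (i, n)) => m mn /=.
by rewrite ltnS (leq_bigmax (Ordinal mn)).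
Qed.

End Souslin.

(** An open set is the union of the closed sets [C n] of points staying away from its complement.
    Interiors of balls are taken because balls of a pseudometric type need not be open. *)
Lemma open_souslin {R : archiRealFieldType} {T : pseudoMetricType R} (A : set T) :
  open A -> souslin A.
Proof.
move=> oA; pose C (n : nat) := ~` \bigcup_(y in ~` A) (ball y (n.+1%:R^-1 : R))°.
rewrite (_ : A = \bigcup_n C n).
  apply: bigcup_souslin => n; apply: closed_souslin; apply: open_closedC.
  by apply: bigcup_open => y _; exact: open_interior.
apply/seteqP; split=> x.
  move=> Ax; have /nbhs_ballP[e /= e0 eA] : nbhs x A by exact: open_nbhs_nbhs.
  exists (Num.bound e^-1) => // -[y nAy] /interior_subset xy; apply: nAy; apply: eA.
  apply/ball_sym; apply: le_ball xy.
  rewrite invf_ple ?posrE//.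
  have := archi_boundP (ltW (_ : 0 < e^-1)); rewrite invr_gt0 => /(_ e0) /ltW /le_trans; apply.
  by rewrite ler_nat.
move=> [n _ Cx]; apply: contrapT => nAx; apply: Cx; exists x => //.
exact: nbhsx_ballx.
Qed.

(** Souslin sets are not stable under complement, so the induction runs over the sets that are
    Souslin together with their complement. *)
Lemma borel_souslin {R : realType} {T : pseudoMetricType R} (A : set T) :
  borel_set A -> souslin A.
Proof.
move=> bA; suff [] : souslin A /\ souslin (~` A) by [].
apply: (smallest_sub (X := fun A => souslin A /\ souslin (~` A))) bA; last first.
  move=> U oU; split; first exact: open_souslin.
  by apply: closed_souslin; exact: open_closedC.
split.
- split; first by apply: closed_souslin; exact: closed0.
  by rewrite setC0; apply: closed_souslin; exact: closedT.
- by move=> B [sB sBC]; rewrite setTD setCK.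
- move=> B sB; split; first by apply: bigcup_souslin => i; have [] := sB i.
  by rewrite setC_bigcup; apply: bigcap_souslin => i; have [] := sB i.
Qed.

(** * Bounding the branches of a Souslin scheme *)

Section Capacitability.
Context {R : realType} {T : topologicalType} {C : countType}.
Variables (c : nat -> T -> C) (w : nat -> R).
Hypothesis w_ge0 : forall k, 0 <= w k.
Hypothesis nest : forall k x y, c k.+1 x = c k.+1 y -> c k x = c k y.
Variable F : nat -> (nat -> nat) -> set T.
Hypothesis sF : souslin_scheme F.

Let tube (S : set (nat -> nat)) : set T := [set x | exists2 f, S f & forall n, F n f x].

(** The coordinates of the branches are bounded one after the other. The sets obtained by bounding
    one coordinate increase to the whole set, so by [content_bigcup] some bound keeps the content
    above [a]. *)
Lemma content_souslin (Q : set T) (a : R) :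
  (a%:E < content c w ([set x | exists f, forall n, F n f x] `&` Q))%E ->
  exists b : nat -> nat, forall n, (a%:E < content c w
    ([set x | exists2 f, (forall i, (i < n)%N -> (f i <= b i)%N) &
       forall m, F m f x] `&` Q))%E.
Proof.
move=> aA.
have step nS : exists v, (a%:E < content c w (tube nS.2 `&` Q))%E ->
    (a%:E < content c w (tube (nS.2 `&` [set f | (f nS.1 <= v)%N]) `&` Q))%E.
  case: nS => n S /=; apply: contrapT => nv.
  have aS : (a%:E < content c w (tube S `&` Q))%E.
    by apply: contrapT => aS; apply: nv; exists 0%N.
  pose A v := tube (S `&` [set f | (f n <= v)%N]) `&` Q.
  have Aa v : (content c w (A v) <= a%:E)%E.
    by rewrite leNgt; apply/negP => aAv; apply: nv; exists v.
  have Am : forall u v, (u <= v)%N -> A u `<=` A v.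
    move=> u v uv x [[f [Sf fu] Ff] Qx]; split=> //.
    by exists f => //; split=> //; exact: leq_trans uv.
  have := content_bigcup w_ge0 nest Am Aa; rewrite leNgt => /negP; apply.
  apply: lt_le_trans aS _; apply: le_content => x [[f Sf Ff] Qx].
  by exists (f n) => //; split=> //; exists f => //; split=> //=.
have /choice[g Hg] := step.
pose S := fix S n := if n is m.+1 then S m `&` [set f | (f m <= g (m, S m))%N] else setT.
have aS n : (a%:E < content c w (tube (S n) `&` Q))%E.
  elim: n => [|n IH]; last exact: (Hg (n, S n)).
  apply: lt_le_trans aA _; apply: le_content => x [[f Ff] Qx].
  by split=> //; exists f.
exists (fun n => g (n, S n)) => n; apply: lt_le_trans (aS n) _.
apply: le_content => x [[f Sf Ff] Qx]; split=> //; exists f => //.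
elim: n Sf => [//|n IH] /= [Sf fn] i; rewrite ltnS leq_eqVlt => /predU1P[->//|].
exact: IH.
Qed.

(** Only finitely many bounded prefixes of length [n] matter, so this is a finite union of closed
    sets; the induction splits off the first coordinate. *)
Lemma closed_bounded_branches n (G : (nat -> nat) -> set T) (b : nat -> nat) :
  (forall f, closed (G f)) ->
  (forall f g, (forall i, (i < n)%N -> f i = g i) -> G f = G g) ->
  closed [set x | exists2 f, (forall i, (f i <= b i)%N) & G f x].
Proof.
elim: n G b => [|n IH] G b cG dG.
  rewrite (_ : [set x | _] = G (fun=> 0%N)) //; apply/seteqP; split=> x.
    by move=> [f _]; rewrite (dG f (fun=> 0%N)).
  by exists (fun=> 0%N).
pose cn v (f : nat -> nat) i := if i is j.+1 then f j else v.
rewrite (_ : [set x | _] = \big[setU/set0]_(v <- iota 0 (b 0%N).+1)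
    [set x | exists2 f, (forall i, (f i <= b i.+1)%N) & G (cn v f) x]).
  apply: closed_bigsetU => v _.
  apply: (IH (fun f => G (cn v f)) (fun i => b i.+1)) => [f|f g fg]; first exact: cG.
  by apply: dG => -[|i]//=; exact: fg.
have vin v : (v \in iota 0 (b 0%N).+1) = (v <= b 0%N)%N by rewrite mem_iota add0n ltnS.
rewrite -bigcup_seq; apply/seteqP; split=> x.
  move=> [f fb Gf]; exists (f 0%N); first exact: (etrans (vin _) (fb 0%N)).
  exists (fun i => f i.+1) => //; rewrite (dG _ f)// => i _.
  by case: i.
move=> [v vi [f fb Gf]]; have vb : (v <= b 0%N)%N by rewrite -vin.
by exists (cn v f) => // -[|i]/=.
Qed.

(** König's lemma on the tree of prefixes bounded by [b]: [good n f] says that the prefix of length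
    [n] of [f] has extensions that pass the tests up to any given depth. *)
Lemma konig_souslin (b : nat -> nat) x :
  (forall n, exists2 f, (forall i, (f i <= b i)%N) &
    forall m, (m <= n)%N -> F m f x) ->
  exists f, forall n, F n f x.
Proof.
move=> Kx; have [_ dF] := sF.
pose good n f := forall N, exists g, [/\ forall i, (g i <= b i)%N,
  forall i, (i < n)%N -> g i = f i & forall m, (m <= N)%N -> F m g x].
pose upd n (f : nat -> nat) v i := if i == n then v else f i.
have step nf : exists v, good nf.1 nf.2 -> good nf.1.+1 (upd nf.1 nf.2 v).
  case: nf => n f /=; apply: contrapT => nv.
  have gn : good n f by apply: contrapT => ng; apply: nv; exists 0%N.
  (* If each next value [v] failed at a depth [N v], an extension of [f] reaching the largest of
     these depths over the values up to [b n] would be a contradiction. *)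
  have /choice[N HN] v : exists N, ~ exists g, [/\ forall i, (g i <= b i)%N,
      forall i, (i < n.+1)%N -> g i = upd n f v i & forall m, (m <= N)%N -> F m g x].
    by apply: contrapT => H; apply: nv; exists v => _ N; apply: contrapT => H'; apply: H; exists N.
  have [g [gb gf gF]] := gn (\max_(v < (b n).+1) N v).
  apply: (HN (g n)); exists g; split=> // [i|m mN].
    by rewrite ltnS /upd; case: eqP => [->//|/eqP ni ni']; apply: gf; rewrite ltn_neqAle ni.
  apply: gF; apply: leq_trans mN _.
  have gn' : (g n < (b n).+1)%N by rewrite ltnS.
  exact: (leq_bigmax (Ordinal gn')).
have /choice[h Hh] := step.
pose s := fix s n := if n is m.+1 then upd m (s m) (h (m, s m)) else fun=> 0%N.
have gs n : good n (s n).
  elim: n => [N|n IH]; last exact: (Hh (n, s n)).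
  by have [g gb gF] := Kx N; exists g.
have sE n i : (i < n)%N -> s n i = s i.+1 i.
  elim: n => [//|n IH]; rewrite ltnS leq_eqVlt => /predU1P[->//|ni].
  by rewrite -(IH ni) /= /upd (ltn_eqF ni).
exists (fun i => s i.+1 i) => n; have [g [_ gE /(_ n (leqnn n))]] := gs n n.
by rewrite (dF n g (fun i => s i.+1 i))// => i ni; rewrite gE// sE.
Qed.

End Capacitability.

(** * Frostman's lemma for Borel sets *)

Lemma compact_decreasing {T : topologicalType} (B : set T) (Kn : nat -> set T)
    (U : set T) : compact B -> (forall n, closed (Kn n)) -> (forall n, Kn n `<=` B) ->
  (forall n m, (n <= m)%N -> Kn m `<=` Kn n) -> open U -> \bigcap_n Kn n `<=` U ->
  exists n, Kn n `<=` U.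
Proof.
move=> /compact_near_coveringP cB cK KB Km oU KU.
have [|n _ /(_ n (leqnn n)) H] := cB nat \oo (fun n y => Kn n y -> U y) _.
  move=> x Bx; have [Ux|nUx] := pselect (U x).
    have : nbhs x U by exact: open_nbhs_nbhs.
    move=> xU; exists (U, setT) => /=; first by split=> //; exact: filterT.
    by move=> [y m] [/= Uy _] _.
  have [n nKx] : exists n, ~ Kn n x.
    by apply: contrapT => H; apply: nUx; apply: KU => n _; apply: contrapT => nK; apply: H; exists n.
  exists (~` Kn n, [set m | (n <= m)%N]) => /=.
    split; last by exists n.
    by apply: open_nbhs_nbhs; split=> //; exact: closed_openC.
  by move=> [y m] [/= nKy nm] /(Km _ _ nm).
by exists n => y Ky; apply: H => //; exact: KB Ky.
Qed.

(** The compact segment contains a cluster point, and an ultrafilter converges to each of its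
    cluster points. *)
Lemma ultra_bounded_cvg {R : realType} {I : Type} (G : set_system I) (u : I -> R) a b :
  UltraFilter G -> (forall i, a <= u i <= b) -> exists l : R, u @ G --> l.
Proof.
move=> UG uab; have FG : ProperFilter G := ultra_proper.
have Gu : (u @ G) `[a, b]%classic by apply: nearW => i; rewrite /= in_itv/= uab.
have [l [_ cl]] := @segment_compact R a b (u @ G) _ Gu.
exists l => A lA.
have [//|GA] := in_ultra_setVsetC (u @^-1` A) UG.
have GA' : (u @ G) (~` A) by [].
by have [x []] := cl _ _ GA' lA.
Qed.

Section FrostmanBorel.
Context {R : realType}.
Implicit Types (K : set 'rV[R]_2) (s : R).

Definition box (D : R) : set 'rV[R]_2 := [set y | forall i, `|y 0 i| <= D].

Lemma box_compact D : compact (box D).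
Proof.
have := @rV_compact R 2 (fun=> `[- D, D]%classic) (fun=> @segment_compact R _ _).
congr compact; apply/seteqP; split=> y /= H i; have := H i.
  by rewrite in_itv/= ler_norml.
by rewrite ler_norml in_itv.
Qed.

Lemma box_closed D : closed (box D).
Proof. by apply: compact_closed; [exact: norm_hausdorff|exact: box_compact]. Qed.

(** [K] is restricted to a unit dyadic square, and its branches are bounded with the content kept
    above [a]. The measures [m n] obey the growth bound down to level [n] and are normalised before
    passing to the limit. They live on [A n] rather than on [K'], so concentration on [K'] is
    expressed through open neighbourhoods. *)
Lemma frostman_borel K s : 0 < s -> borel_set K -> ~ cnull s K ->
  exists (K' : set 'rV[R]_2) (mu : set 'rV[R]_2 -> R) (D C : R),
    [/\ compact K', K' `<=` K & K' `<=` box D] /\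
    [/\ fadd mu, mu setT = 1,
        forall U, open U -> K' `<=` U -> mu U = 1 &
        forall p r, 0 < r <= 1 -> mu (sq p r) <= C * r `^ s].
Proof.
move=> s0 /borel_souslin[F [sF KF]] nK.
have [t nKt] : exists t, ~ cnull s (K `&` [set x | dyad 0 x = t]).
  apply: contrapT => H; apply: nK.
  pose A i : set 'rV[R]_2 := if (unpickle i : option (int * int)) is Some t
    then K `&` [set x | dyad 0 x = t] else set0.
  apply: (@sub_cnull _ _ s _ (\bigcup_i A i)).
    move=> x Kx; have [i Ei] : exists i, unpickle i = Some (dyad 0 x).
      by eexists; exact: pickleK.
    by exists i => //; rewrite /A Ei.
  apply: bigcup_cnull => // i; rewrite /A; case: (unpickle i) => [t|].
    by apply: contrapT => nt; apply: H; exists t.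
  move=> e e0; exists (fun=> set0), (fun=> 0); split; [by move=> ? []|by []|by move=> ? ? ? []|].
    by rewrite eseries0 ?lee_fin ?ltW// => k _ _; rewrite powR0 ?gt_eqF.
set Q := [set x | dyad 0 x = t] in nKt.
have w0 := dcost_ge0 s.
have nst k (x y : 'rV[R]_2) : dyad k.+1 x = dyad k.+1 y -> dyad k x = dyad k y.
  by move=> /(dyad_nest k x y)[].
have fin A : A `<=` Q -> content dyad (dcost s) A \is a fin_num.
  by move=> AQ; apply: (content_fin w0 (k := 0%N) (t := t)) => x /AQ.
have cK : (0 < content dyad (dcost s) (K `&` Q))%E.
  rewrite lt0e content_ge0// andbT; apply/eqP => c0; apply: nKt.
  exact: content0_cnull.
pose a := fine (content dyad (dcost s) (K `&` Q)) / 2.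
have f0 : 0 < fine (content dyad (dcost s) (K `&` Q)).
  by rewrite fine_gt0// cK ltey_eq fin.
have a0 : 0 < a by rewrite divr_gt0.
have aK : (a%:E < content dyad (dcost s) (K `&` Q))%E.
  by rewrite -(fineK (fin _ _))// lte_fin /a; lra.
rewrite KF in aK; have [b aA] := content_souslin w0 nst aK.
pose A n := [set x | exists2 f, (forall i, (i < n)%N -> (f i <= b i)%N) &
  forall m, F m f x] `&` Q.
have {}aA n : (a%:E < content dyad (dcost s) (A n))%E by exact: aA.
pose D : R := `|t.1%:~R| + `|t.2%:~R| + 1.
have QD : Q `<=` box D.
  have flD z : `|z| <= `|(fl 0 z)%:~R : R| + 1.
    have := floor_itv (2 ^+ 0 * z); rewrite -/(fl 0 z) expr0 mul1r intrD/=.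
    move: (fl 0 z)%:~R => g /andP[g1 g2].
    have -> : z = g + (z - g) by rewrite addrC subrK.
    apply: le_trans (ler_normD _ _) _; rewrite lerD2l ler_norml.
    by apply/andP; split; lra.
  move=> x; rewrite /Q/= => xt i; rewrite /D -xt /dyad /=.
  have [->|->] : i = 0 \/ i = 1.
    by case: i => [[|[|//]] i2]; [left|right]; exact: val_inj.
  - by apply: le_trans (flD _) _; rewrite lerD2r lerDl.
  - by apply: le_trans (flD _) _; rewrite lerD2r lerDr.
(* [A n] bounds [n] coordinates and tests all levels, whereas [Kn n] bounds all coordinates and
   tests the levels up to [n], which makes it closed. *)
pose Kn n := [set x | exists2 f, (forall i, (f i <= b i)%N) &
  (\bigcap_(m in [set m | (m <= n)%N]) F m f) x] `&` box D.
have cKn n : closed (Kn n).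
  apply: closedI; last exact: box_closed.
  apply: (@closed_bounded_branches _ n) => [f|f g fg].
    by apply: closed_bigI => m _; have [+ _] := sF; exact.
  have [_ dF] := sF; apply: eq_bigcapr => m /= mn; apply: dF => i im.
  by apply: fg; exact: leq_trans im mn.
have Kmon n m : (n <= m)%N -> Kn m `<=` Kn n.
  move=> nm x [[f fb Ff] Bx]; split=> //; exists f => // k /= kn.
  by apply: Ff => /=; exact: leq_trans nm.
have AKn n m : (m <= n)%N -> A n `<=` Kn m.
  move=> mn x [[f fb Ff] Qx]; split; last exact: QD.
  (* Values from index [n] on are reset to 0 to obey the bound [b]; the levels up to [m] do not see
     the change. *)
  exists (fun i => if (i < n)%N then f i else 0%N) => [i|k /= km].
    by case: ifP => // /fb.
  have [_ dF] := sF; rewrite (dF k _ f)// => i ik.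
  by rewrite (leq_trans ik (leq_trans km mn)).
have /choice[m Hm] n := @tree_frostman _ _ _ _ _ _ _ w0 dyad_nest n 0 t (A n)
  (fun x Ax => Ax.2).
pose M n := m n setT.
have Ma n : a <= M n.
  rewrite /M; have [_ -> _ _] := Hm n.
  by rewrite -lee_fin fineK ?ltW// fin// => x [].
have M0 n : 0 < M n by exact: lt_le_trans (Ma n).
have [G [UG oG]] := @ultraFilterLemma _ (\oo : set_system nat) _.
have FG : ProperFilter G := ultra_proper.
have mf n : fadd (m n) by have [] := Hm n.
have u01 S n : 0 <= m n S / M n <= 1.
  have [m0 _] := mf n.
  by rewrite divr_ge0 ?(ltW (M0 n))//= ler_pdivrMr// mul1r; exact: le_fadd.
have /choice[mu Hmu] S := ultra_bounded_cvg UG (u01 S).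
(* The factor 9 * 4^s comes from [square_mass]; the division by [a] accounts for the normalisation
   by [M n], which is at least [a]. *)
exists (\bigcap_n Kn n), mu, D, (9 * 4 `^ s / a); split; split.
- apply: (@subclosed_compact _ _ (box D)); last 2 first.
  + exact: box_compact.
  + by move=> x /(_ 0%N Logic.I)[].
  by apply: closed_bigI => n _; exact: cKn.
- move=> x Kx; rewrite KF; apply: (konig_souslin sF (b := b)) => n.
  by have [[f fb Ff] _] := Kx n Logic.I; exists f.
- by move=> x /(_ 0%N Logic.I)[].
- split=> [S|S S' SS'].
    by apply: cvgr_to_ge (Hmu S) _; apply: nearW => n; have /andP[] := u01 S n.
  apply: (norm_cvg_unique (Hmu (S `|` S'))).
  rewrite (_ : (fun n => _) = (fun n => m n S / M n) + (fun n => m n S' / M n)).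
    exact: cvgD.
  by apply/funext => n /=; rewrite fctE -mulrDl; have [_ ->] := mf n.
- apply: (norm_cvg_unique (Hmu setT)).
  rewrite (_ : (fun n => _) = (fun=> 1)); first exact: cvg_cst.
  by apply/funext => n; rewrite -/(M n) divff// gt_eqF// M0.
- move=> U oU KU.
  have [n KnU] := compact_decreasing (@box_compact D) cKn (fun n x Kx => Kx.2) Kmon oU KU.
  apply: (norm_cvg_unique (Hmu U)).
  apply: cvg_near_cst; apply: oG.
  exists n => // k /= nk; have [fm _ mA _] := Hm k.
  rewrite -[RHS](@divff _ (M k)) ?gt_eqF ?M0//; congr (_ / _).
  apply/eqP; rewrite eq_le (le_fadd fm)//= -subr_ge0.
  rewrite -(opprB (M k)) oppr_ge0 -(faddC _ fm) -mA; apply: le_fadd => // x nUx Ax.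
  by apply: nUx; apply: KnU; exact: AKn nk _ Ax.
- move=> p r r01; have [k rk] := dyadic_scale r01; have /andP[r0 _] := r01.
  apply: cvgr_to_le (Hmu (sq p r)) _; apply: oG; exists k => // n /= kn.
  have [fm _ _ mle] := Hm n.
  have := square_mass p fm s0 kn (fun l y ln => mle l y ln) rk.
  rewrite powRM ?(ltW r0)// => H; rewrite ler_pdivrMr//.
  apply: le_trans (H) _.
  have -> : 9 * 4 `^ s / a * r `^ s * m n setT = 9 * (4 `^ s * r `^ s) * (M n / a).
    by rewrite /M; ring.
  by rewrite ler_peMr ?mulr_ge0 ?powR_ge0// ler_pdivlMr// mul1r.
Qed.

End FrostmanBorel.

(** * Strips *)

Lemma norm_MD_le {R : realDomainType} (a b c d A B C D : R) :
  `|a| <= A -> `|b| <= B -> `|c| <= C -> `|d| <= D ->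
  `|a * b + c * d| <= A * B + C * D.
Proof.
move=> aA bB cC dD; apply: le_trans (ler_normD _ _) _; rewrite !normrM.
by apply: lerD; apply: ler_pM.
Qed.

Lemma norm_MB_le {R : realDomainType} (a b c d A B C D : R) :
  `|a| <= A -> `|b| <= B -> `|c| <= C -> `|d| <= D ->
  `|a * b - c * d| <= A * B + C * D.
Proof. by move=> aA bB cC dD; rewrite -mulNr norm_MD_le// normrN. Qed.

Section Strips.
Context {R : realType}.
Implicit Types (g h : R * R * R) (x y p q : 'rV[R]_2) (S : set 'rV[R]_2).

(** The triple [g] holds the coefficients of an affine function. Under [unit_lin], the absolute
    value of [lin g y] is the distance from [y] to the line where [lin g] vanishes. *)
Definition lin g y : R := g.1.1 * y 0 0 + g.1.2 * y 0 1 + g.2.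

Definition unit_lin g : Prop := g.1.1 ^+ 2 + g.1.2 ^+ 2 = 1.

Definition strip (D : R) g (r : R) : set 'rV[R]_2 :=
  [set y | box D y /\ `|lin g y| <= r].

Definition small (t : R) S : Prop :=
  forall p q, S p -> S q -> `|p 0 0 - q 0 0| <= t /\ `|p 0 1 - q 0 1| <= t.

Lemma le_strip D g r r' : r <= r' -> strip D g r `<=` strip D g r'.
Proof. by move=> rr' y [By gy]; split=> //; exact: le_trans rr'. Qed.

Lemma unit_lin_coord g : unit_lin g -> `|g.1.1| <= 1 /\ `|g.1.2| <= 1.
Proof.
rewrite /unit_lin => g1; split; rewrite -(@ler_pXn2r _ 2)// ?nnegrE// expr1n real_normK ?num_real//.
  by rewrite -g1 lerDl sqr_ge0.
by rewrite -g1 lerDr sqr_ge0.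
Qed.

(** Two common points more than [t] apart fix the directions of both lines up to an error of order
    [(a + b) / t], and over the box this error is amplified at most by a multiple of [D]. *)
Lemma sub_strip D g h a b t p q : unit_lin g -> unit_lin h ->
  1 <= D -> 0 < t <= 1 -> (strip D g a `&` strip D h b) p ->
  (strip D g a `&` strip D h b) q ->
  ~ (`|p 0 0 - q 0 0| <= t /\ `|p 0 1 - q 0 1| <= t) ->
  strip D g a `<=` strip D h (40 * D * (a + b) / t).
Proof.
move=> g1 h1 D1 /andP[t0 t1] [[Bp gp] [_ hp]] [[Bq gq] [_ hq]] npq y [By gy].
split=> //.
have [ga gb] := unit_lin_coord g1; have [ha hb] := unit_lin_coord h1.
set u0 := p 0 0 - q 0 0 in npq; set u1 := p 0 1 - q 0 1 in npq.
pose w0 := y 0 0 - p 0 0; pose w1 := y 0 1 - p 0 1.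
pose m := Num.max `|u0| `|u1|.
have tm : t < m.
  rewrite ltNge; apply/negP; rewrite ge_max => /andP[? ?]; exact: npq.
have m0 : 0 < m by exact: lt_trans tm.
have u0m : `|u0| <= m by rewrite le_max lexx.
have u1m : `|u1| <= m by rewrite le_max lexx orbT.
have a0 : 0 <= a by exact: le_trans gy.
have b0 : 0 <= b by exact: le_trans hp.
have dB (z z' : 'rV[R]_2) i : box D z -> box D z' -> `|z 0 i - z' 0 i| <= 2 * D.
  by move=> Bz Bz'; apply: le_trans (ler_normB _ _) _; have := Bz i; have := Bz' i; lra.
have w0D : `|w0| <= 2 * D by exact: dB.
have w1D : `|w1| <= 2 * D by exact: dB.
have mD : m <= 2 * D by rewrite ge_max !dB.
have gu : `|g.1.1 * u0 + g.1.2 * u1| <= 2 * a.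
  have -> : g.1.1 * u0 + g.1.2 * u1 = lin g p - lin g q by rewrite /lin /u0 /u1; ring.
  by apply: le_trans (ler_normB _ _) _; lra.
have gw : `|g.1.1 * w0 + g.1.2 * w1| <= 2 * a.
  have -> : g.1.1 * w0 + g.1.2 * w1 = lin g y - lin g p by rewrite /lin /w0 /w1; ring.
  by apply: le_trans (ler_normB _ _) _; lra.
have hu : `|h.1.1 * u0 + h.1.2 * u1| <= 2 * b.
  have -> : h.1.1 * u0 + h.1.2 * u1 = lin h p - lin h q by rewrite /lin /u0 /u1; ring.
  by apply: le_trans (ler_normB _ _) _; lra.
(* The cross product of ([u0], [u1]) and ([w0], [w1]) is computed in the orthonormal frame formed by
   the normal of [g] and its rotation. *)
have uw : `|u0 * w1 - u1 * w0| <= 16 * a * D.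
  have -> : u0 * w1 - u1 * w0 =
      (g.1.1 * u0 + g.1.2 * u1) * (g.1.1 * w1 - g.1.2 * w0) -
      (g.1.1 * u1 - g.1.2 * u0) * (g.1.1 * w0 + g.1.2 * w1).
    by rewrite -[LHS]mul1r -g1; ring.
  have c1 := norm_MB_le ga w1D gb w0D.
  have c2 := norm_MB_le ga u1m gb u0m.
  have := norm_MB_le gu c1 c2 gw; nra.
have hw : m ^+ 2 * `|h.1.1 * w0 + h.1.2 * w1| <= m * ((8 * b + 32 * a) * D).
  apply: (@le_trans _ _ `|(u0 ^+ 2 + u1 ^+ 2) * (h.1.1 * w0 + h.1.2 * w1)|).
    rewrite normrM; apply: ler_wpM2r => //; rewrite ger0_norm ?addr_ge0 ?sqr_ge0//.
    rewrite -(real_normK (num_real u0)) -(real_normK (num_real u1)) /m.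
    by rewrite maxEle; case: ifP => _; rewrite ?lerDl ?lerDr sqr_ge0.
  (* Both [h] and ([w0], [w1]) are expanded in the orthogonal basis formed by ([u0], [u1]) and its
     rotation by a right angle. *)
  have -> : (u0 ^+ 2 + u1 ^+ 2) * (h.1.1 * w0 + h.1.2 * w1) =
    (h.1.1 * u0 + h.1.2 * u1) * (u0 * w0 + u1 * w1) +
    (u0 * h.1.2 - u1 * h.1.1) * (u0 * w1 - u1 * w0) by ring.
  have c1 := norm_MD_le u0m w0D u1m w1D.
  have c2 := norm_MB_le u0m hb u1m ha.
  have := norm_MD_le hu c1 c2 uw; lra.
have {}hw : `|h.1.1 * w0 + h.1.2 * w1| <= (8 * b + 32 * a) * D / t.
  rewrite ler_pdivlMr//; apply: le_trans (_ : `|h.1.1 * w0 + h.1.2 * w1| * m <= _).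
    by rewrite ler_wpM2l// ltW.
  by rewrite -(ler_pM2l m0) mulrCA -expr2 mulrC.
have -> : lin h y = lin h p + (h.1.1 * w0 + h.1.2 * w1) by rewrite /lin /w0 /w1; ring.
apply: le_trans (ler_normD _ _) _; apply: le_trans (lerD hp hw) _.
have bt : b <= b * D / t by rewrite ler_pdivlMr//; nra.
have -> : 40 * D * (a + b) / t = (8 * b + 32 * a) * D / t + 8 * (a * D / t) + 32 * (b * D / t) by field; rewrite gt_eqF.
have : 0 <= a * D / t by rewrite divr_ge0 ?(ltW t0)// mulr_ge0//; lra.
have : 0 <= b * D / t by rewrite divr_ge0 ?(ltW t0)// mulr_ge0//; lra.
lra.
Qed.

End Strips.

(** The covers remain cheap after scaling by [L], and the bounds become strict, so that later the
    sets they define can be taken open and compactness applies. *)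
Lemma cnull_scaled {R : realType} n (t : R) (A : set 'rV[R]_n) L e : 0 < t ->
  cnull t A -> 0 < L -> 0 < e ->
  exists (F : nat -> set 'rV[R]_n) (r : nat -> R),
    [/\ A `<=` \bigcup_k F k, forall k, 0 < r k,
        forall k p q, F k p -> F k q -> L * enorm (p - q) < r k &
        forall m, \sum_(k < m) r k `^ t <= e].
Proof.
move=> t0 nA L0 e0; pose B := (2 * L) `^ t.
have B0 : 0 < B by rewrite powR_gt0// mulr_gt0.
pose eta := e / (2 * B); have eta0 : 0 < eta by rewrite divr_gt0// mulr_gt0.
have [F [d [AF d0 Fd de]]] := nA _ eta0.
(* The [ep k] keep the radii positive when [d k = 0]. Their [t]-th powers sum to at most [eta], and
   [B * (eta + eta)] is [e]. *)
pose ep k := (eta / (2 ^ k.+1)%:R) `^ t^-1.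
have ep0 k : 0 < ep k by rewrite powR_gt0// divr_gt0// ltr0n expn_gt0.
have ept k : ep k `^ t = eta / (2 ^ k.+1)%:R.
  by rewrite /ep -powRrM mulVf ?gt_eqF// powRr1// divr_ge0// ltW.
have md k : 0 < Num.max (d k) (ep k) by rewrite lt_max ep0 orbT.
exists F, (fun k => 2 * L * Num.max (d k) (ep k)); split=> //.
- by move=> k; rewrite !mulr_gt0.
- move=> k p q Fp Fq; rewrite -mulrA mulrCA ltr_pM2l//.
  apply: (@le_lt_trans _ _ (Num.max (d k) (ep k))); last by have := md k; lra.
  by rewrite le_max Fd.
move=> m; apply: (@le_trans _ _ (B * (\sum_(k < m) d k `^ t + \sum_(k < m) eta / (2 ^ k.+1)%:R))).
  rewrite -big_split/= mulr_sumr; apply: ler_sum => k _.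
  rewrite powRM ?(ltW (md k)) ?mulr_ge0 ?(ltW L0)// ler_pM2l// -ept.
  by case: (leP (d k) (ep k)) => _; rewrite ?lerDl ?lerDr powR_ge0.
have E : e = B * (eta + eta) by rewrite /eta; field; rewrite gt_eqF.
rewrite [leRHS]E ler_pM2l//; apply: lerD.
  by apply: partial_sum_le de => k; exact: powR_ge0.
apply: partial_sum_le (epsilon_trick0 xpredT (ltW eta0)) => k.
by rewrite divr_ge0// ltW.
Qed.

(** * Thin strips have uniformly small mass *)

Section UniformStrips.
Context {R : realType}.
Implicit Types (g h : R * R * R) (x y p q : 'rV[R]_2).

Lemma lin_continuous g : continuous (fun y : 'rV[R]_2 => `|lin g y|).
Proof.
have c i : continuous (fun y : 'rV[R]_2 => y 0 i) := @coord_continuous R 1 2 0 i.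
have cl : continuous (lin g : 'rV[R]_2 -> R).
  move=> y; apply: (@continuousD _ R^o _ (fun y : 'rV[R]_2 => g.1.1 * y 0 0 + g.1.2 * y 0 1) (fun=> g.2)).
    apply: (@continuousD _ R^o _ (fun y : 'rV[R]_2 => g.1.1 * y 0 0) (fun y => g.1.2 * y 0 1)).
      by apply: (@continuousM _ _ (fun=> g.1.1) (fun y : 'rV[R]_2 => y 0 0)); [exact: cst_continuous|exact: c].
    by apply: (@continuousM _ _ (fun=> g.1.2) (fun y : 'rV[R]_2 => y 0 1)); [exact: cst_continuous|exact: c].
  exact: cst_continuous.
by move=> y; exact: (continuous_comp (cl y) (@norm_continuous _ R^o _)).
Qed.

Lemma open_lin_lt g (r : R) : open [set y | `|lin g y| < r].
Proof. by apply: open_comp (@open_lt R r) => y _; exact: lin_continuous. Qed.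

Lemma open_lin_gt g (r : R) : open [set y | r < `|lin g y|].
Proof. by apply: open_comp (@open_gt R r) => y _; exact: lin_continuous. Qed.

Definition osq p (r : R) : set 'rV[R]_2 :=
  [set y | `|lin (1, 0, - p 0 0) y| < r] `&` [set y | `|lin (0, 1, - p 0 1) y| < r].

Lemma osqE p r y : osq p r y <-> `|y 0 0 - p 0 0| < r /\ `|y 0 1 - p 0 1| < r.
Proof. by rewrite /osq /lin /= !mul0r !mul1r addr0 add0r. Qed.

Lemma osq_open p r : open (osq p r).
Proof. by apply: openI; exact: open_lin_lt. Qed.

Lemma closed_unit_lin : closed [set g : R * R * R | unit_lin g].
Proof.
pose f (g : R * R * R) : R := g.1.1 * g.1.1 + g.1.2 * g.1.2.
rewrite (_ : [set g | _] = f @^-1` [set 1]); last first.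
  by apply/seteqP; split=> g; rewrite /unit_lin /f /= !expr2.
apply: closed_comp => [g _|]; last exact: closed_eq.
have c1 : {for g, continuous (fun g : R * R * R => g.1.1)}.
  by apply: (@continuous_comp _ _ _ fst fst); [exact: cvg_fst|exact: cvg_fst].
have c2 : {for g, continuous (fun g : R * R * R => g.1.2)}.
  by apply: (@continuous_comp _ _ _ fst snd); [exact: cvg_fst|exact: cvg_snd].
apply: (@continuousD _ R^o _ (fun g : R * R * R => g.1.1 * g.1.1)
  (fun g : R * R * R => g.1.2 * g.1.2)).
  exact: (continuousM c1 c1).
exact: (continuousM c2 c2).
Qed.

Lemma compact_unit_lin (M : R) :
  compact ([set g : R * R * R | unit_lin g] `&` [set g | `|g.2| <= M]).
Proof.
pose B := (`[-1, 1]%classic `*` `[-1, 1]%classic `*` `[- M, M]%classic : set (R * R * R)).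
have cB : compact B.
  by apply: compact_setX; [apply: compact_setX|]; exact: segment_compact.
rewrite (_ : _ `&` _ = B `&` [set g | unit_lin g]).
  by apply: compact_closedI => //; exact: closed_unit_lin.
apply/seteqP; split=> g /=.
  move=> [g1 g2]; have [ga gb] := unit_lin_coord g1; split => //.
  by rewrite /B/= !in_itv/= -!ler_norml.
by move=> [[[? ?]]]; rewrite /= in_itv/= -ler_norml.
Qed.

Section Mu.
Variables (K : set 'rV[R]_2) (mu : set 'rV[R]_2 -> R) (D C s : R).
Hypotheses (D1 : 1 <= D) (s0 : 0 < s) (K_compact : compact K) (KD : K `<=` box D).
Hypotheses (fmu : fadd mu) (muU : forall U, open U -> K `<=` U -> mu U = 1).
Hypothesis muC : forall p r, 0 < r <= 1 -> mu (sq p r) <= C * r `^ s.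

Lemma frost_const_ge0 : 0 <= C.
Proof.
have [m0 _] := fmu; have := muC (0 : 'rV[R]_2) (r := 1).
rewrite ltr01 lexx powR1 mulr1 => /(_ isT); exact: le_trans (m0 _).
Qed.

Lemma mu_supp U : open U -> K `<=` U -> mu (~` U) = 0.
Proof.
move=> oU KU; rewrite faddC// (muU oU KU) (muU openT) ?subrr//.
Qed.

(** Small open squares cover the part of [K] on the line, and near any other point of [K] the
    distance to the line is bounded below. By compactness finitely many squares and a single [c]
    suffice, as the merely finitely additive [mu] demands. *)
Lemma line_nbhd g e : 0 < e -> cnull s (K `&` [set y | lin g y = 0]) ->
  exists (U : set 'rV[R]_2) c, [/\ open U, mu U <= e, 0 < c &
    forall y, K y -> U y \/ c < `|lin g y|].
Proof.
move=> e0 nK; have C0 := frost_const_ge0.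
pose e' := Num.min 1 (e / (C + 1)).
have e'0 : 0 < e' by rewrite lt_min ltr01 divr_gt0//; lra.
have [F [r [KF r0 Fr re]]] := cnull_scaled s0 nK ltr01 e'0.
have rk1 k : 0 < r k <= 1.
  rewrite r0/= leNgt; apply/negP => r1.
  have : 1 `^ s < r k `^ s by rewrite gt0_ltr_powR// nnegrE ?ltW.
  rewrite powR1 ltNge => /negP; apply; have := re k.+1; rewrite le_min => /andP[+ _].
  rewrite big_ord_recr/=; apply: le_trans; rewrite lerDr sumr_ge0// => i _.
  exact: powR_ge0.
have /choice[p Hp] k : exists p, forall y, F k y -> osq p (r k) y.
  have [[p Fp]|nF] := pselect (exists p, F k p); last first.
    by exists 0 => y Fy; case: nF; exists y.
  exists p => y Fy; apply/osqE; have := Fr k _ _ Fy Fp; rewrite mul1r => yp.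
  by split; apply: le_lt_trans yp; have := coord_le_enorm (y - p);
    [move=> /(_ 0)|move=> /(_ 1)]; rewrite !mxE.
pose U n : set 'rV[R]_2 := [set y | exists2 k, (k < n)%N & osq (p k) (r k) y].
have oU n : open (U n).
  rewrite (_ : U n = \bigcup_(k in [set k | (k < n)%N]) osq (p k) (r k)).
    by apply: bigcup_open => k _; exact: osq_open.
  by apply/seteqP; split=> y [k kn yk]; exists k.
have [|n _ /(_ n (leqnn n)) H] := (compact_near_coveringP K).1 K_compact nat \oo
    (fun n y => U n y \/ n.+1%:R^-1 < `|lin g y|) _.
  move=> y Ky; have [gy|gy] := eqVneq (lin g y) 0.
    have [k _ Fk] := KF _ (conj Ky gy).
    exists (osq (p k) (r k), [set n | (k < n)%N]) => /=.
      split; last by exists k.+1.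
      by apply: open_nbhs_nbhs; split; [exact: osq_open|exact: Hp].
    by move=> [y' n] [/= yk kn]; left; exists k.
  pose a := `|lin g y| / 2; have a0 : 0 < a by rewrite divr_gt0// normr_gt0.
  exists ([set y | a < `|lin g y|], [set n | (Num.bound a^-1 <= n)%N]) => /=.
    split; last by exists (Num.bound a^-1).
    apply: open_nbhs_nbhs; split; first exact: open_lin_gt.
    have : 0 < `|lin g y| by rewrite normr_gt0.
    by rewrite /= /a; lra.
  move=> [y' n] [/= ay' an]; right; apply: le_lt_trans ay'.
  rewrite invf_ple ?posrE//.
  have := archi_boundP (ltW (_ : 0 < a^-1)); rewrite invr_gt0 => /(_ a0) /ltW /le_trans; apply.
  by rewrite ler_nat (leq_trans an).
exists (U n), n.+1%:R^-1; split=> //.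
apply: le_trans (fadd_bigcup_le n (fun k => osq (p k) (r k)) fmu) _.
apply: (@le_trans _ _ (C * \sum_(k < n) r k `^ s)).
  rewrite mulr_sumr; apply: ler_sum => k _; apply: le_trans (muC (p k) (rk1 k)).
  by apply: le_fadd => // y /osqE[y0 y1]; split; exact: ltW.
apply: (@le_trans _ _ (C * (e / (C + 1)))).
  by apply: ler_wpM2l => //; apply: le_trans (re n) _; rewrite ge_min lexx orbT.
rewrite mulrCA ler_piMr ?(ltW e0)// ler_pdivrMr; lra.
Qed.

(** The neighbourhood given by [line_nbhd] serves all lines close to [g], and unit lines with
    bounded constant term form a compact set. If the constant term exceeds [3 * D], the line is so
    far from the box that the strip is empty. *)
Lemma uniform_strips e : 0 < e ->
  (forall g, unit_lin g -> cnull s (K `&` [set y | lin g y = 0])) ->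
  exists2 t, 0 < t & forall g, unit_lin g -> mu (strip D g t) <= e.
Proof.
move=> e0 nK.
have [|t /= t0 H] := (compact_near_coveringP _).1 (@compact_unit_lin (3 * D)) R 0^'+
    (fun t g => mu (strip D g t) <= e) _.
  move=> g [/= g1 _]; have [U [c [oU Ue c0 KU]]] := line_nbhd e0 (nK g g1).
  have D21 : 0 < 2 * D + 1 by move: D1; lra.
  (* Affine functions whose coefficients are within [d] differ by at most [c / 2] on the box. *)
  pose d : R := c / (2 * (2 * D + 1)); have d0 : 0 < d by rewrite divr_gt0// mulr_gt0.
  exists (ball g d, [set t | t < c / 2]) => /=.
    split; first exact: nbhsx_ballx.
    by apply: nbhs_right_lt; rewrite divr_gt0.
  move=> [h t] [/= [[ha hb] hc] tc].
  pose O := U `|` [set y | c / 2 < `|lin h y|].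
  have oO : open O by apply: openU => //; exact: open_lin_gt.
  have KO : K `<=` O.
    move=> y Ky; have [|cy] := KU y Ky; [by left|right=> /=].
    have Dy := KD Ky.
    have gh : `|lin g y - lin h y| <= d * (2 * D + 1).
      have -> : lin g y - lin h y = ((g.1.1 - h.1.1) * y 0 0 + (g.1.2 - h.1.2) * y 0 1) + (g.2 - h.2).
        by rewrite /lin; ring.
      apply: le_trans (ler_normD _ _) _.
      have := norm_MD_le (ltW ha) (Dy 0) (ltW hb) (Dy 1).
      by move: (ltW hc); rewrite /ball/=; lra.
    have dc : d * (2 * D + 1) = c / 2 by rewrite /d; field; lra.
    rewrite dc in gh.
    have := ler_normD (lin h y) (lin g y - lin h y); rewrite subrKC; lra.
  apply: (@le_trans _ _ (mu (U `|` ~` O))).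
    apply: le_fadd => // y [_ /= yt]; have [Uy|nUy] := pselect (U y); [by left|right].
    by case=> //=; lra.
  by apply: le_trans (faddU_le _ _ fmu) _; rewrite (mu_supp oO KO) addr0.
pose t' := Num.min (t / 2) D.
have D0 : 0 < D by move: D1; lra.
have t'0 : 0 < t' by rewrite lt_min divr_gt0.
exists t' => // g g1.
have [gD|gD] := leP `|g.2| (3 * D).
  apply: (H t') => //=; rewrite /ball/= sub0r normrN gtr0_norm// gt_min.
  by apply/orP; left; lra.
rewrite (_ : strip D g t' = set0) ?fadd0 ?(ltW e0)//; apply/seteqP; split=> // y [By].
rewrite leNgt => /negP; apply; apply: (@le_lt_trans _ _ D); first by rewrite ge_min lexx orbT.
have [ga gb] := unit_lin_coord g1.
have := norm_MD_le ga (By 0) gb (By 1).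
have := ler_normB (lin g y) (g.1.1 * y 0 0 + g.1.2 * y 0 1).
rewrite [X in `|X| <= _](_ : _ = g.2); last by rewrite /lin; ring.
by move: gD; lra.
Qed.

End Mu.
End UniformStrips.

(** * Heavy strips *)

Section HeavyStrips.
Context {R : realType}.
Implicit Types (g h : R * R * R) (x y p q : 'rV[R]_2).

Lemma bonferroni {X : Type} (mu : set X -> R) (T : nat -> set X) (b e : R) n :
  fadd mu -> 0 <= e -> (forall i, (i < n)%N -> b <= mu (T i)) ->
  (forall i j, (i < j)%N -> (j < n)%N -> mu (T j `&` T i) <= e) ->
  n%:R * (b - n%:R * e) <= mu [set x | exists2 k, (k < n)%N & T k x].
Proof.
move=> fm e0; elim: n => [|n IH] hT hI; first by rewrite mul0r; have [] := fm.
set U := [set x | exists2 k, (k < n)%N & T k x] in IH.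
have {}IH : n%:R * (b - n%:R * e) <= mu U.
  by apply: IH => [i ni|i j ij jn]; [apply: hT|apply: hI => //]; exact: ltnW.
have E : mu [set x | exists2 k, (k < n.+1)%N & T k x] = mu (T n) + mu U - mu (T n `&` U).
  rewrite -faddU//; congr mu; apply/seteqP; split=> x.
    by move=> [k]; rewrite ltnS leq_eqVlt => /predU1P[->|kn] Tk; [left|right; exists k].
  by move=> [Tn|[k kn Tk]]; [exists n|exists k => //; exact: ltnW].
have I : mu (T n `&` U) <= n%:R * e.
  apply: (@le_trans _ _ (mu [set x | exists2 k, (k < n)%N & (T n `&` T k) x])).
    by apply: le_fadd => // x [Tn [k kn Tk]]; exists k.
  apply: le_trans (fadd_bigcup_le n (fun k => T n `&` T k) fm) _.
  apply: le_trans (ler_sum _ (fun (k : 'I_n) _ => hI k n (ltn_ord k) (ltnSn n))) _.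
  by rewrite sumr_const card_ord -[leLHS]mulr_natl.
have := hT n (ltnSn n); rewrite E -natr1.
have n0 : 0 <= n%:R :> R by [].
nra.
Qed.

(** Otherwise the first [k] sets have z = k b between 2 and 3, and [bonferroni] would give z (1 - z
    / 8) at most 1, which is false in that range. *)
Lemma few_heavy {X : Type} (mu : set X -> R) (T : nat -> set X) (b : R) n :
  fadd mu -> mu setT = 1 -> 0 < b -> (forall i, (i < n)%N -> b <= mu (T i)) ->
  (forall i j, (i < j)%N -> (j < n)%N -> mu (T j `&` T i) <= b ^+ 2 / 8) ->
  n%:R <= 2 / b.
Proof.
move=> fm m1 b0 hT hI; rewrite leNgt; apply/negP => nb.
pose k := (Num.truncn (2 / b)).+1.
have b2 : 0 < 2 / b by rewrite divr_gt0.
have := truncn_itv (ltW b2); rewrite -/k => /andP[k1 k2].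
have kn : (k <= n)%N.
  by rewrite /k -(@ltr_nat R); apply: le_lt_trans nb.
have b1 : b <= 1.
  by rewrite -[leRHS]m1; apply: le_trans (hT 0%N _) _; [exact: leq_trans kn|exact: le_fadd].
have k3 : k%:R <= 3 / b.
  have -> : 3 / b = 2 / b + b^-1 by field; rewrite gt_eqF.
  by rewrite /k -natr1; apply: lerD => //; rewrite invf_ge1.
have := @bonferroni _ mu T b (b ^+ 2 / 8) k fm.
have e0 : 0 <= b ^+ 2 / 8 by rewrite divr_ge0// sqr_ge0.
move=> /(_ e0) H.
have {}H : k%:R * (b - k%:R * (b ^+ 2 / 8)) <= 1.
  rewrite -[leRHS]m1; apply: le_trans (H _ _) _; last exact: le_fadd.
  - by move=> i ik; apply: hT; exact: leq_trans kn.
  - by move=> i j ij jk; apply: hI => //; exact: leq_trans kn.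
move: H k2 k3; set K : R := k%:R => H k2 k3.
have k2' : 2 < K * b by rewrite -ltr_pdivrMr.
have k3' : K * b <= 3 by rewrite -ler_pdivlMr.
move: H; rewrite (_ : K * (b - K * (b ^+ 2 / 8)) = K * b * (1 - K * b / 8)); last by ring.
move: k2' k3'; set z := K * b; nra.
Qed.

Variables (mu : set 'rV[R]_2 -> R) (D C s t : R).
Hypotheses (D1 : 1 <= D) (s0 : 0 < s).
Hypotheses (fmu : fadd mu) (mu1 : mu setT = 1) (C0 : 0 <= C).
Hypothesis muC : forall p r, 0 < r <= 1 -> mu (sq p r) <= C * r `^ s.
Let b := t `^ (s / 4).
Hypotheses (t01 : 0 < t <= 1) (Cb : C * b ^+ 2 <= 8^-1) (Dt : 80 * D * t <= 1).

Let b0 : 0 < b. Proof. by rewrite powR_gt0//; case/andP: t01. Qed.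

Let b4 : b ^+ 4 = t `^ s.
Proof.
rewrite -powR_mulrn ?(ltW b0)// -powRrM.
by congr (_ `^ _); field.
Qed.

(** Since [b ^+ 4] is t^s, the Frostman bound factors as [b ^+ 2 * (C * b ^+ 2)], and [Cb] turns it
    into the overlap tolerated by [few_heavy]. *)
Lemma small_mass (S : set 'rV[R]_2) : small t S -> mu S <= b ^+ 2 / 8.
Proof.
move=> sS; have [[p Sp]|nS] := pselect (exists p, S p); last first.
  rewrite (_ : S = set0) ?fadd0 ?divr_ge0 ?sqr_ge0//; apply/seteqP; split=> // p Sp.
  by case: nS; exists p.
apply: (@le_trans _ _ (C * t `^ s)).
  by apply: le_trans (muC p t01); apply: le_fadd => // y Sy; exact: sS.
have -> : C * t `^ s = b ^+ 2 * (C * b ^+ 2) by rewrite -b4; ring.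
by apply: ler_wpM2l => //; exact: sqr_ge0.
Qed.

(* A maximal family of heavy strips with small pairwise intersections: by
   Bonferroni it is finite, and any other heavy strip meets one of its members
   in a large set, hence is nearly parallel and close to it. *)
Lemma heavy_lines : exists (N : nat) (g : nat -> R * R * R),
  [/\ N%:R <= 2 / b, forall i, (i < N)%N -> unit_lin (g i) &
   forall h, unit_lin h -> b <= mu (strip D h (t ^+ 8)) ->
     exists2 i, (i < N)%N & strip D h (t ^+ 8) `<=` strip D (g i) (80 * D * t ^+ 7)].
Proof.
pose T (g : nat -> R * R * R) i := strip D (g i) (t ^+ 8).
pose P n := `[< exists g : nat -> R * R * R, [/\ forall i, (i < n)%N -> unit_lin (g i),
  forall i, (i < n)%N -> b <= mu (T g i) &
  forall i j, (i < j)%N -> (j < n)%N -> small t (T g j `&` T g i)] >].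
have exP : exists n, P n by exists 0%N; apply/asboolP; exists (fun=> (0, 0, 0)).
have Pb n : P n -> n%:R <= 2 / b.
  move=> /asboolP[g [_ gb gs]]; apply: few_heavy fmu mu1 b0 gb _ => i j ij jn.
  exact: small_mass (gs i j ij jn).
have Pm n : P n -> (n <= Num.truncn (2 / b))%N.
  move=> /Pb nb; rewrite -ltnS -(@ltr_nat R); apply: le_lt_trans nb _.
  by have /andP[] := truncn_itv (ltW (divr_gt0 (ltr0n R 2) b0)).
case: (ex_maxnP exP Pm) => N PN Nmax; have := PN => /asboolP[g [g1 gb gs]].
exists N, g; split=> //; first exact: Pb.
move=> h h1 hb; apply: contrapT => nh.
pose g' i := if (i < N)%N then g i else h.
suff : P N.+1 by move=> /Nmax; rewrite ltnn.
have /andP[t0 t1] := t01.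
apply/asboolP; exists g'; split.
- by move=> i _; rewrite /g'; case: ifP => // /g1.
- by move=> i _; rewrite /T /g'; case: ifP => // /gb.
move=> i j ij; rewrite ltnS leq_eqVlt => /predU1P[jN|jN]; last first.
  by rewrite /T /g' jN (ltn_trans ij jN); exact: gs.
have iN : (i < N)%N by rewrite -jN.
rewrite /T /g' jN ltnn iN => p q Sp Sq; apply: contrapT => npq.
apply: nh; exists i => //.
have := sub_strip h1 (g1 i iN) D1 t01 Sp Sq npq.
rewrite (_ : 40 * D * (t ^+ 8 + t ^+ 8) / t = 80 * D * t ^+ 7)//.
by rewrite (exprS t 7); field; rewrite gt_eqF.
Qed.

(** The sets [W i j] are the small intersections among the fattened strips of [heavy_lines]. If [x]
    avoids them, any two fattened strips through [x] have a large intersection, so by [sub_strip]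
    all of them lie in one strip of width [t ^+ 4]. *)
Lemma concentration : exists (N : nat) (W : nat -> nat -> set 'rV[R]_2),
  [/\ N%:R <= 2 / b, forall i j, small t (W i j) &
   forall x, box D x -> (forall i j, (i < N)%N -> (j < N)%N -> ~ W i j x) ->
   exists V : set 'rV[R]_2,
    (forall h, unit_lin h -> b <= mu (strip D h (t ^+ 8)) ->
      strip D h (t ^+ 8) x -> strip D h (t ^+ 8) `<=` V) /\
    (V = set0 \/ exists h, [/\ unit_lin h, V = strip D h (t ^+ 4) & V x])].
Proof.
have [N [g [Nb g1 gh]]] := heavy_lines; have /andP[t0 t1] := t01.
pose T i := strip D (g i) (80 * D * t ^+ 7).
exists N, (fun i j => if pselect (small t (T i `&` T j)) then T i `&` T j else set0).
split=> // [i j|x Bx nW]; first by case: pselect => // _ ? ? [].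
have [[h0 [h01 h0b h0x]]|nh] := pselect (exists h, [/\ unit_lin h,
    b <= mu (strip D h (t ^+ 8)) & strip D h (t ^+ 8) x]); last first.
  exists set0; split; last by left.
  by move=> h h1 hb hx; case: nh; exists h.
have [j jN h0T] := gh _ h01 h0b.
exists (strip D (g j) (t ^+ 4)); split; last first.
  right; exists (g j); split=> //; first exact: g1.
  apply: le_strip (h0T _ h0x).
  have -> : 80 * D * t ^+ 7 = 80 * D * t * t ^+ 2 * t ^+ 4 by ring.
  rewrite ler_piMl ?exprn_ge0 ?(ltW t0)//.
  by rewrite mulr_ile1 ?exprn_ile1 ?exprn_ge0 ?mulr_ge0 ?(ltW t0)//; move: D1; lra.
move=> h h1 hb hx; have [i iN hT] := gh _ h1 hb.
apply: (subset_trans hT) => y Ty.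
have := nW i j iN jN; case: pselect => [sT nWx|nS _].
  by case: nWx; split; [exact: hT|exact: h0T].
have [p [q [Sp [Sq npq]]]] : exists p q, (T i `&` T j) p /\ (T i `&` T j) q /\
    ~ (`|p 0 0 - q 0 0| <= t /\ `|p 0 1 - q 0 1| <= t).
  apply: contrapT => H; apply: nS => p q Sp Sq; apply: contrapT => npq.
  by apply: H; exists p, q.
have := sub_strip (g1 i iN) (g1 j jN) D1 t01 Sp Sq npq Ty; apply: le_strip.
(* The factor in front of [t ^+ 4] is the square of [80 * D * t], hence at most 1 by [Dt]. *)
have -> : 40 * D * (80 * D * t ^+ 7 + 80 * D * t ^+ 7) / t = (80 * D * t) ^+ 2 * t ^+ 4.
  by rewrite (exprS t 6); field; rewrite gt_eqF.
rewrite ler_piMl ?exprn_ge0 ?(ltW t0)// exprn_ile1// ?mulr_ge0 ?(ltW t0)//.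
by move: D1; lra.
Qed.

End HeavyStrips.

(** * Exceptional points *)

Section Radial.
Context {R : realType}.
Implicit Types (g h : R * R * R) (x y p q : 'rV[R]_2).

Lemma coordB_le_enorm p q i : `|p 0 i - q 0 i| <= enorm (p - q).
Proof. by have := coord_le_enorm (p - q) i; rewrite !mxE. Qed.

Lemma enorm_gt0 x y : y != x -> 0 < enorm (y - x).
Proof.
move=> yx; rewrite lt_def enorm_ge0 andbT; apply/eqP => e0.
have := coord_le_enorm (y - x); rewrite e0 => c.
move/eqP: yx; apply; apply/rowP => i; apply/eqP; rewrite -subr_eq0 -normr_le0.
by have := c i; rewrite !mxE.
Qed.

Lemma radial_projE x y i : y != x ->
  y 0 i - x 0 i = enorm (y - x) * radial_proj x y 0 i.
Proof.
by move=> /enorm_gt0 yx; rewrite /radial_proj !mxE mulVKf// gt_eqF.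
Qed.

Lemma radial_proj_unit x y : y != x ->
  radial_proj x y 0 0 ^+ 2 + radial_proj x y 0 1 ^+ 2 = 1.
Proof.
move=> /enorm_gt0 yx; rewrite /radial_proj !mxE.
have := sqr_enorm2 (y - x); rewrite !mxE; move: (enorm _) yx => r r0 E.
by rewrite !exprMn -mulrDr -E -exprMn mulVf ?expr1n// gt_eqF.
Qed.

Definition through x (e : 'rV[R]_2) : R * R * R :=
  (- e 0 1, e 0 0, e 0 1 * x 0 0 - e 0 0 * x 0 1).

Lemma lin_through x e : lin (through x e) x = 0.
Proof. by rewrite /lin /through /=; ring. Qed.

(** The left side is the distance between [x] and [y] times the absolute cross product of the two
    directions, which does not change when one direction is subtracted from the other. *)
Lemma lin_through_radial (D : R) x y y' : box D x -> box D y -> y != x -> y' != x ->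
  `|lin (through x (radial_proj x y')) y| <=
    8 * D * enorm (radial_proj x y - radial_proj x y').
Proof.
move=> Bx By yx y'x; set e := radial_proj x y'; set f := radial_proj x y.
have e1 : unit_lin (e 0 0, e 0 1, 0) by exact: radial_proj_unit.
have [/= ea eb] := unit_lin_coord e1.
have -> : lin (through x e) y = enorm (y - x) * (e 0 0 * (f 0 1 - e 0 1) - e 0 1 * (f 0 0 - e 0 0)).
  transitivity (e 0 0 * (y 0 1 - x 0 1) - e 0 1 * (y 0 0 - x 0 0)).
    by rewrite /lin /through /=; ring.
  by rewrite (radial_projE 0 yx) (radial_projE 1 yx) -/f; ring.
have c0 := coordB_le_enorm f e 0; have c1 := coordB_le_enorm f e 1.
have dB i : `|(y - x) 0 i| <= 2 * D.
  by rewrite !mxE; apply: le_trans (ler_normB _ _) _; have := By i; have := Bx i; lra.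
have r4 := enorm_le_coord (dB 0) (dB 1).
rewrite normrM (ger0_norm (enorm_ge0 _)).
apply: (@le_trans _ _ (2 * (2 * D) * (2 * enorm (f - e)))); last by lra.
apply: ler_pM => //; first exact: enorm_ge0.
by apply: le_trans (norm_MB_le ea c1 eb c0) _; lra.
Qed.

End Radial.

(** * Doubly exponential scales *)

Section Scales.
Context {R : realType}.
Variables (s t : R).
Hypotheses (s0 : 0 < s) (t0 : 0 < t) (t2 : t <= 2^-1).

(** Squaring at each step gives [scale k.+1 ^+ 4 = scale k ^+ 8]: the strip [V k.+1] has exactly the
    width tested for heaviness at level [k]. *)
Definition scale k := t ^+ (2 ^ k).
Definition weight k := scale k `^ (s / 4).

Lemma scale_gt0 k : 0 < scale k. Proof. by rewrite exprn_gt0. Qed.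

Lemma scaleS k : scale k.+1 = scale k ^+ 2.
Proof. by rewrite /scale expnS mulnC exprM. Qed.

Lemma t_le1 : t <= 1. Proof. by move: t2; lra. Qed.

Lemma scale_le k : scale k <= t.
Proof. by rewrite /scale ler_iXnr ?expn_gt0 ?(ltW t0) ?t_le1. Qed.

Lemma weight_gt0 k : 0 < weight k. Proof. by rewrite powR_gt0// scale_gt0. Qed.

Lemma weightS k : weight k.+1 = weight k ^+ 2.
Proof. by rewrite /weight scaleS expr2 powRM ?(ltW (scale_gt0 _))// expr2. Qed.

Lemma weight_pow4 k : weight k ^+ 4 = scale k `^ s.
Proof.
rewrite -powR_mulrn ?(ltW (weight_gt0 k))// -powRrM.
by congr (_ `^ _); field.
Qed.

Lemma weight_le k : weight k <= t `^ (s / 4).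
Proof.
apply: ge0_ler_powR; rewrite ?nnegrE ?(ltW t0) ?(ltW (scale_gt0 k)) ?divr_ge0 ?(ltW s0)//.
exact: scale_le.
Qed.

Lemma weight_half k : t `^ (s / 4) <= 2^-1 -> weight k.+1 <= weight k / 2.
Proof.
move=> w2; rewrite weightS expr2; apply: ler_wpM2l; first exact: ltW (weight_gt0 k).
exact: le_trans (weight_le k) w2.
Qed.

Lemma sum_weight n : t `^ (s / 4) <= 2^-1 -> \sum_(k < n) weight k <= 2 * t `^ (s / 4).
Proof.
move=> w2; have w00 : weight 0 = t `^ (s / 4) by rewrite /weight /scale expr1.
suff : \sum_(k < n) weight k <= 2 * t `^ (s / 4) - 2 * weight n.
  by have := weight_gt0 n; lra.
elim: n => [|n IH]; first by rewrite big_ord0 w00 subrr.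
by rewrite big_ord_recr/=; have := weight_half n w2; lra.
Qed.

Lemma scale_level (r : R) : 0 < r <= t ^+ 8 ->
  exists k, scale k.+1 ^+ 8 < r <= scale k ^+ 8.
Proof.
move=> /andP[r0 rt].
have r1 : 0 < r <= 1 by rewrite r0 (le_trans rt)// exprn_ile1 ?t_le1 ?ltW.
have exk : exists k, scale k.+1 ^+ 8 < r.
  have [k /andP[kr _]] := dyadic_scale r1; exists k; apply: le_lt_trans kr.
  apply: (@le_trans _ _ (scale k.+1)).
    by rewrite ler_iXnr// ?(ltW (scale_gt0 _)) ?(le_trans (scale_le _) t_le1).
  rewrite -exprVn; apply: (@le_trans _ _ (t ^+ k.+1)).
    by rewrite /scale ler_wiXn2l ?(ltW t0) ?t_le1// ltnW// ltn_expl.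
  by rewrite lerXn2r// nnegrE ?invr_ge0// ltW.
case: (ex_minnP exk) => -[kr _|k kr kmin].
  by exists 0%N; rewrite kr /scale expn0 expr1.
exists k.+1; rewrite kr/= leNgt; apply/negP => /kmin.
by rewrite ltnn.
Qed.

(** Here [scale k.+1 ^+ 8] is [scale k ^+ 16], and 16 times [s / 64] is the exponent [s / 4] of
    [weight]. *)
Lemma weight_level k (r : R) : scale k.+1 ^+ 8 < r -> weight k <= r `^ (s / 64).
Proof.
move=> kr; have sk := ltW (scale_gt0 k).
have -> : weight k = (scale k.+1 ^+ 8) `^ (s / 64).
  rewrite scaleS -exprM -[in RHS]powR_mulrn// -powRrM; congr (_ `^ _).
  by rewrite natrM; field.
have s8 : 0 < scale k.+1 ^+ 8 by rewrite exprn_gt0// scale_gt0.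
apply: ge0_ler_powR; rewrite ?nnegrE.
- by rewrite divr_ge0// ltW.
- exact: ltW s8.
- exact: ltW (lt_trans s8 kr).
- exact: ltW.
Qed.

End Scales.

(** * Smallness of the set of exceptional points *)

Section Exceptional.
Context {R : realType}.
Implicit Types (g h : R * R * R) (x y p q : 'rV[R]_2).
Variables (K : set 'rV[R]_2) (mu : set 'rV[R]_2 -> R) (D C s : R).
Hypotheses (D1 : 1 <= D) (s0 : 0 < s) (K_compact : compact K) (KD : K `<=` osq 0 D).
Hypotheses (fmu : fadd mu) (muU : forall U, open U -> K `<=` U -> mu U = 1).
Hypothesis muC : forall p r, 0 < r <= 1 -> mu (sq p r) <= C * r `^ s.

Let C0 : 0 <= C := frost_const_ge0 fmu muC.

Lemma sub_osq_box : osq 0 D `<=` box D.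
Proof.
move=> y /osqE; rewrite !mxE !subr0 => -[y0 y1] i.
have [->|->] : i = 0 \/ i = 1.
  by case: i => [[|[|//]] i2]; [left|right]; exact: val_inj.
all: exact: ltW.
Qed.

Section Point.
Variables (t : R) (x : 'rV[R]_2) (V : nat -> set 'rV[R]_2).
Hypotheses (t0 : 0 < t) (t2 : t <= 2^-1) (tb : t `^ (s / 4) <= 16^-1).
Hypothesis strip_le : forall g, unit_lin g -> mu (strip D g (t ^+ 4)) <= 8^-1.
Hypothesis Bx : box D x.
Hypothesis V_heavy : forall k h, unit_lin h ->
  weight s t k <= mu (strip D h (scale t k ^+ 8)) ->
  strip D h (scale t k ^+ 8) x -> strip D h (scale t k ^+ 8) `<=` V k.
Hypothesis V_strip : forall k,
  V k = set0 \/ exists h, [/\ unit_lin h, V k = strip D h (scale t k ^+ 4) & V k x].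

(** A nonempty [V n.+1] is a strip through [x] of the width tested at level [n]: either it is heavy
    and contained in [V n], or it adds at most [weight s t n]. *)
Lemma nested_strips n :
  mu [set y | exists2 k, (k < n.+1)%N & V k y] <= 8^-1 + \sum_(k < n) weight s t k.
Proof.
elim: n => [|n IH].
  rewrite big_ord0 addr0; apply: (@le_trans _ _ (mu (V 0%N))).
    by apply: le_fadd => // y [k]; rewrite ltnS leqn0 => /eqP ->.
  have [->|[h [h1 -> _]]] := V_strip 0; first by rewrite fadd0.
  by rewrite /scale expn0 expr1 strip_le.
have w0 := ltW (weight_gt0 s t0 n); rewrite big_ord_recr/= addrA.
set A := [set y | exists2 k, (k < n.+1)%N & V k y] in IH.
have AS : [set y | exists2 k, (k < n.+2)%N & V k y] `<=` A `|` V n.+1.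
  by move=> y [k]; rewrite ltnS leq_eqVlt => /predU1P[->|kn] Vy; [right|left; exists k].
have [VA|VA] := pselect (V n.+1 `<=` A).
  apply: (@le_trans _ _ (mu A)); last by apply: le_trans IH _; rewrite lerDl.
  by apply: le_fadd => //; apply: subset_trans AS _; rewrite subUset; split.
apply: (@le_trans _ _ (mu A + mu (V n.+1))).
  by apply: le_trans (faddU_le _ _ fmu); exact: le_fadd.
apply: lerD => //.
have [V0|[h [h1 Vh Vx]]] := V_strip n.+1; first by rewrite V0 fadd0.
rewrite leNgt; apply/negP => /ltW wV; apply: VA => y Vy; exists n => //.
have E : V n.+1 = strip D h (scale t n ^+ 8) by rewrite Vh scaleS -exprM.
by apply: (V_heavy h1); rewrite -E.
Qed.

Lemma no_small_radial : ~ cnull (s / 64) (radial_proj x @` (K `\ x)).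
Proof.
move=> nP; have s64 : 0 < s / 64 by rewrite divr_gt0.
have D80 : 0 < 8 * D by rewrite mulr_gt0//; move: D1; lra.
(* The first entry bounds the mass of the light strips; the second keeps every [r j] at most
   [t ^+ 8], as [scale_level] requires. *)
pose e := Num.min 8^-1 ((t ^+ 8) `^ (s / 64)).
have e0 : 0 < e by rewrite lt_min invr_gt0 powR_gt0 ?exprn_gt0//= ltr0n.
have [F [r [KF r0 Fr re]]] := cnull_scaled s64 nP D80 e0.
have rt j : 0 < r j <= t ^+ 8.
  rewrite r0/= leNgt; apply/negP => rj.
  have : (t ^+ 8) `^ (s / 64) < r j `^ (s / 64).
    by rewrite gt0_ltr_powR// nnegrE ?exprn_ge0// ltW.
  rewrite ltNge => /negP; apply; have := re j.+1; rewrite le_min => /andP[_].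
  rewrite big_ord_recr/=; apply: le_trans; rewrite lerDr sumr_ge0// => i _.
  exact: powR_ge0.
have /choice[g Hg] j : exists g, [/\ unit_lin g, lin g x = 0 &
    forall y, K y -> y != x -> F j (radial_proj x y) -> `|lin g y| < r j].
  have [[y' [Ky' y'x Fy']]|nF] := pselect (exists y', [/\ K y', y' != x & F j (radial_proj x y')]).
    exists (through x (radial_proj x y')); split.
    - by have := radial_proj_unit y'x; rewrite /unit_lin /through/= sqrrN addrC.
    - exact: lin_through.
    move=> y Ky yx Fy; apply: le_lt_trans (Fr j _ _ Fy Fy').
    by apply: lin_through_radial => //; exact: sub_osq_box (KD Ky).
  exists (1, 0, - x 0 0); split; first by rewrite /unit_lin/= expr1n expr0n addr0.
    by rewrite /lin/=; ring.
  by move=> y Ky yx Fy; case: nF; exists y.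
(* Chosen so that C rho^s is at most 1/8. The open square of this size around [x] is needed for the
   finite subcover, because the strips come from points other than [x]. *)
pose rho := Num.min 1 ((8 * (C + 1))^-1 `^ s^-1).
have C1 : 0 < 8 * (C + 1) by rewrite mulr_gt0// ltr_wpDl.
have rho0 : 0 < rho by rewrite lt_min ltr01 powR_gt0// invr_gt0.
have rho1 : 0 < rho <= 1 by rewrite rho0 ge_min lexx.
have Crho : mu (sq x rho) <= 8^-1.
  apply: le_trans (muC x rho1) _; apply: (@le_trans _ _ (C * (8 * (C + 1))^-1)).
    apply: ler_wpM2l => //.
    have E : (8 * (C + 1))^-1 = ((8 * (C + 1))^-1 `^ s^-1) `^ s.
      by rewrite -powRrM mulVf ?gt_eqF// powRr1// invr_ge0 ltW.
    rewrite [leRHS]E.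
    apply: ge0_ler_powR; rewrite ?nnegrE ?powR_ge0 ?(ltW rho0) ?(ltW s0)//.
    by rewrite ge_min lexx orbT.
  rewrite ler_pdivrMr//; lra.
have [|n _ /(_ n (leqnn n)) HK] := (compact_near_coveringP K).1 K_compact nat \oo
    (fun n y => osq x rho y \/ exists2 j, (j < n)%N & `|lin (g j) y| < r j) _.
  move=> y Ky; have [->|yx] := eqVneq y x.
    exists (osq x rho, setT) => /=; last by move=> [y' n] [/= ? _]; left.
    split; last exact: filterT.
    apply: open_nbhs_nbhs; split; first exact: osq_open.
    by apply/osqE; rewrite !subrr normr0.
  have [|j _ Fj] := KF (radial_proj x y).
    by exists y => //; split=> //; exact/eqP.
  exists ([set y | `|lin (g j) y| < r j], [set n | (j < n)%N]) => /=.
    split; last by exists j.+1.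
    apply: open_nbhs_nbhs; split; first exact: open_lin_lt.
    by have [_ _ H] := Hg j; exact: H.
  by move=> [y' n] [/= yj jn]; right; exists j.
pose U := (osq x rho `|` \bigcup_(j in [set j | (j < n)%N]) [set y | `|lin (g j) y| < r j])
  `&` osq 0 D.
have oU : open U.
  apply: openI; last exact: osq_open.
  apply: openU; first exact: osq_open.
  by apply: bigcup_open => j _; exact: open_lin_lt.
have KU : K `<=` U.
  move=> y Ky; split; last exact: KD.
  by have [?|[j jn yj]] := HK y Ky; [left|right; exists j].
have muU1 := muU oU KU.
have /choice[ka Hka] j := scale_level t0 t2 (rt j).
pose S j := strip D (g j) (scale t (ka j) ^+ 8).
pose L j := if mu (S j) < weight s t (ka j) then S j else set0.
pose M := \max_(j < n) ka j.
have Ux : U `<=` sq x rho `|` ([set y | exists2 j, (j < n)%N & L j y] `|`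
    [set y | exists2 k, (k < M.+1)%N & V k y]).
  move=> y [[/osqE[y0 y1]|[j /= jn yj]] Dy]; first by left; split; exact: ltW.
  right; have /andP[_ rk] := Hka j.
  have Sy : S j y.
    by split; [exact: sub_osq_box|exact: le_trans (ltW yj) rk].
  have [g1 gx _] := Hg j.
  have [Sw|Sw] := ltP (mu (S j)) (weight s t (ka j)).
    by left; exists j => //; rewrite /L Sw.
  right; exists (ka j); first by rewrite ltnS (leq_bigmax (Ordinal jn)).
  apply: (V_heavy g1) => //; split=> //.
  by rewrite gx normr0 exprn_ge0// ltW// scale_gt0.
have muL j : mu (L j) <= r j `^ (s / 64).
  rewrite /L; case: ifP => [Sw|_]; last by rewrite fadd0 ?powR_ge0.
  apply: le_trans (ltW Sw) _; apply: weight_level => //.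
  by have /andP[] := Hka j.
have mL : mu [set y | exists2 j, (j < n)%N & L j y] <= 8^-1.
  apply: le_trans (fadd_bigcup_le n L fmu) _.
  apply: le_trans (ler_sum _ (fun (j : 'I_n) _ => muL j)) _.
  by apply: le_trans (re n) _; rewrite ge_min lexx.
have mV := nested_strips M.
have t12 : t `^ (s / 4) <= 2^-1 by apply: le_trans tb _; lra.
have sw := sum_weight s0 t0 t2 M t12.
have := le_fadd fmu Ux; rewrite muU1.
have u1 := faddU_le (sq x rho) ([set y | exists2 j, (j < n)%N & L j y] `|`
    [set y | exists2 k, (k < M.+1)%N & V k y]) fmu.
have u2 := faddU_le [set y | exists2 j, (j < n)%N & L j y]
    [set y | exists2 k, (k < M.+1)%N & V k y] fmu.
(* The square and the light strips contribute at most 1/8 each, and the sets [V k] at most 1/8 +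
   2/16: in total 1/2, against a mass of 1. *)
move: u1 u2 mL mV sw Crho tb; lra.
Qed.

End Point.

Lemma esum_const_I (N : nat) (a : R) : 0 <= a ->
  (\esum_(i in `I_N) a%:E = (N%:R * a)%:E)%E.
Proof.
move=> a0; rewrite esum_fset; [|exact: finite_II|by move=> ? _; rewrite lee_fin].
by rewrite -fsbig_ord sumEFin sumr_const card_ord -[in LHS]mulr_natl.
Qed.

(** A point of [E] outside all the [W] would contradict [no_small_radial]. At scale [k] there are at
    most (2 / weight)^2 of these sets, each of cost at most 2^s weight^4, and the resulting totals
    are summable because the weights at least halve at each step. *)
Lemma exceptional_null (E : set 'rV[R]_2) : E `<=` box D ->
  (forall g, unit_lin g -> cnull s (K `&` [set y | lin g y = 0])) ->
  (forall x, E x -> cnull (s / 64) (radial_proj x @` (K `\ x))) -> cnull s E.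
Proof.
move=> ED Kl EP.
have D0 : 0 < D by move: D1; lra.
have KB : K `<=` box D by apply: subset_trans KD _; exact: sub_osq_box.
have [tau tau0 Htau] : exists2 t, 0 < t & forall g, unit_lin g -> mu (strip D g t) <= 8^-1.
  by apply: (uniform_strips D1 s0 K_compact KB fmu muU muC) => //; rewrite invr_gt0.
apply: (@cnull_esum _ _ (nat * (nat * nat))%type) => // e e0.
have p2 : 0 < (2 : R) `^ s by exact: powR_gt0.
(* The entries serve, in order, the mass count in [no_small_radial], the condition on [C] in
   [concentration], and the total cost [e]. *)
pose bs := Num.min (Num.min 16^-1 (8 * (C + 1))^-1) (e / (8 * 2 `^ s)).
have C1 : 0 < 8 * (C + 1) by rewrite mulr_gt0// ltr_wpDl.
have bs0 : 0 < bs by rewrite !lt_min !invr_gt0 C1 divr_gt0 ?mulr_gt0//= andbT ltr0n.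
pose t := Num.min (Num.min 2^-1 tau) (Num.min (80 * D)^-1 (bs `^ (4 / s))).
have t0 : 0 < t by rewrite !lt_min tau0 !invr_gt0 powR_gt0// mulr_gt0//= andbT ltr0n.
have t2 : t <= 2^-1 by rewrite /t !ge_min lexx.
have t1 : t <= 1 by move: t2; lra.
have ttau : t ^+ 4 <= tau.
  apply: (@le_trans _ _ t); first by rewrite ler_iXnr// ltW.
  by rewrite /t !ge_min lexx orbT.
have tD : 80 * D * t <= 1.
  by rewrite mulrC -ler_pdivlMr ?mulr_gt0// mul1r /t !ge_min lexx !orbT.
have tbs : t `^ (s / 4) <= bs.
  have -> : bs = (bs `^ (4 / s)) `^ (s / 4).
    by rewrite -powRrM mulrA divfK ?gt_eqF// divff// powRr1// ltW.
  apply: ge0_ler_powR; rewrite ?nnegrE ?powR_ge0 ?(ltW t0) ?divr_ge0 ?(ltW s0)//.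
  by rewrite /t !ge_min lexx !orbT.
have tb16 : t `^ (s / 4) <= 16^-1 by apply: le_trans tbs _; rewrite /bs !ge_min lexx.
have tbC : t `^ (s / 4) <= (8 * (C + 1))^-1.
  by apply: le_trans tbs _; rewrite /bs !ge_min lexx orbT.
have tbe : t `^ (s / 4) <= e / (8 * 2 `^ s).
  by apply: le_trans tbs _; rewrite /bs !ge_min lexx !orbT.
have mu1 : mu setT = 1 by apply: muU => //; exact: openT.
have /choice[N /choice[W HW]] k : exists N (W : nat -> nat -> set 'rV[R]_2),
    [/\ N%:R <= 2 / weight s t k, forall i j, small (scale t k) (W i j) &
     forall x, box D x -> (forall i j, (i < N)%N -> (j < N)%N -> ~ W i j x) ->
     exists V : set 'rV[R]_2,
      (forall h, unit_lin h -> weight s t k <= mu (strip D h (scale t k ^+ 8)) ->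
        strip D h (scale t k ^+ 8) x -> strip D h (scale t k ^+ 8) `<=` V) /\
      (V = set0 \/ exists h, [/\ unit_lin h, V = strip D h (scale t k ^+ 4) & V x])].
  have sk0 := scale_gt0 t0 k; have sk := scale_le t0 t2 k.
  apply: (concentration (t := scale t k) D1 fmu mu1 muC).
  - by rewrite sk0 (le_trans sk).
  - have w0 := ltW (weight_gt0 s t0 k); have wt := weight_le s0 t0 t2 k.
    have w1 : weight s t k <= 1 by apply: le_trans wt _; apply: le_trans tb16 _; lra.
    apply: (@le_trans _ _ (C * (8 * (C + 1))^-1)); last by rewrite ler_pdivrMr//; lra.
    apply: ler_wpM2l => //; apply: le_trans tbC; apply: le_trans wt.
    by rewrite -/(weight s t k) expr2 ler_piMl.
  - by apply: le_trans tD; rewrite ler_pM2l// mulr_gt0.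
pose S : set (nat * (nat * nat)) := setT `*`` (fun k => `I_(N k) `*`` (fun=> `I_(N k))).
have sc0 k : 0 <= 2 * scale t k by rewrite mulr_ge0// ltW// scale_gt0.
exists S, (fun u => W u.1 u.2.1 u.2.2), (fun u => 2 * scale t u.1); split.
- move=> x Ex; apply: contrapT => nW.
  have /choice[V HV] k : exists V : set 'rV[R]_2,
      (forall h, unit_lin h -> weight s t k <= mu (strip D h (scale t k ^+ 8)) ->
        strip D h (scale t k ^+ 8) x -> strip D h (scale t k ^+ 8) `<=` V) /\
      (V = set0 \/ exists h, [/\ unit_lin h, V = strip D h (scale t k ^+ 4) & V x]).
    have [_ _ H] := HW k; apply: H; first exact: ED.
    by move=> i j iN jN Wx; apply: nW; exists (k, (i, j)).
  apply: (no_small_radial t0 t2 tb16 _ (ED _ Ex) _ _ (EP x Ex)).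
  + by move=> g g1; apply: le_trans (Htau g g1); apply: le_fadd => //; exact: le_strip.
  + by move=> k; have [H _] := HV k; exact: H.
  + by move=> k; have [_ H] := HV k; exact: H.
- by move=> u; exact: sc0.
- move=> u _ p q Wp Wq; have [_ sW _] := HW u.1.
  have [c0 c1] := sW _ _ _ _ Wp Wq.
  by apply: enorm_le_coord; rewrite !mxE.
have aE k : ((2 * scale t k) `^ s)%R = 2 `^ s * weight s t k ^+ 4.
  by rewrite weight_pow4// powRM// ltW// scale_gt0.
rewrite /S -(@esum_esum _ _ _ _ _ (fun k _ => ((2 * scale t k) `^ s)%:E)); last first.
  by move=> *; rewrite lee_fin powR_ge0.
have inner k : (\esum_(j in `I_(N k) `*`` (fun=> `I_(N k))) ((2 * scale t k) `^ s)%:E <=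
    (4 * 2 `^ s * weight s t k)%:E)%E.
  rewrite -(@esum_esum _ _ _ _ _ (fun _ _ => ((2 * scale t k) `^ s)%:E)); last first.
    by move=> *; rewrite lee_fin powR_ge0.
  rewrite (eq_esum (b := fun=> ((N k)%:R * (2 * scale t k) `^ s)%:E)); last first.
    by move=> i _; rewrite esum_const_I// powR_ge0.
  rewrite esum_const_I ?mulr_ge0 ?powR_ge0// lee_fin aE.
  have w0 := weight_gt0 s t0 k; have wt := weight_le s0 t0 t2 k.
  have [Nw _ _] := HW k; rewrite ler_pdivlMr// in Nw.
  have N0 : 0 <= (N k)%:R * weight s t k by rewrite mulr_ge0// ltW.
  have Nw2 : ((N k)%:R * weight s t k) ^+ 2 <= 4.
    by rewrite (_ : 4 = 2 ^+ 2); [rewrite ler_pXn2r// nnegrE|ring].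
  have w1 : weight s t k <= 1 by apply: le_trans wt _; apply: le_trans tb16 _; lra.
  have -> : (N k)%:R * ((N k)%:R * (2 `^ s * weight s t k ^+ 4)) =
      ((N k)%:R * weight s t k) ^+ 2 * (2 `^ s) * weight s t k ^+ 2 by ring.
  apply: ler_pM.
  - by rewrite mulr_ge0 ?sqr_ge0// ltW.
  - exact: sqr_ge0.
  - by apply: ler_wpM2r => //; exact: ltW.
  - by rewrite expr2 ler_piMl// ltW.
apply: (@le_trans _ _ (\esum_(k in [set: nat]) (4 * 2 `^ s * weight s t k)%:E)%E).
  by apply: le_esum => k _; exact: inner.
rewrite -nneseries_esumT; last first.
  by move=> k; rewrite lee_fin !mulr_ge0 ?(ltW p2)// ltW// weight_gt0.
apply: lime_le.
  apply: is_cvg_nneseries => k _ _; rewrite lee_fin !mulr_ge0 ?(ltW p2)// ltW// weight_gt0//.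
apply: nearW => n; rewrite sumEFin lee_fin big_mkord -mulr_sumr.
have t12 : t `^ (s / 4) <= 2^-1 by apply: le_trans tb16 _; lra.
have sw := sum_weight s0 t0 t2 n t12.
apply: (@le_trans _ _ (4 * 2 `^ s * (2 * (e / (8 * 2 `^ s))))).
  apply: ler_wpM2l; first by rewrite mulr_ge0// ltW.
  by apply: le_trans sw _; rewrite ler_pM2l.
by rewrite le_eqVlt; apply/orP; left; apply/eqP; field; rewrite gt_eqF.
Qed.

End Exceptional.

(** * Lines *)

Section Lines.
Context {R : realType}.
Implicit Types (g : R * R * R) (x y : 'rV[R]_2).

Lemma le_cnull n s t (A : set 'rV[R]_n) : 0 < s -> s <= t -> cnull s A -> cnull t A.
Proof.
move=> s0 st nA; apply: (hausdorff_cnull (ltW s0) st (lt_le_trans s0 st)).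
exact: cnull_hausdorff.
Qed.

Lemma unit_line g : unit_lin g -> is_line [set y : 'rV[R]_2 | lin g y = 0].
Proof.
move: g => [[a b] c]; rewrite /unit_lin /= => ab.
(* The foot of the perpendicular from the origin, and the unit normal turned by a right angle. *)
exists (\row_i (if i == 0 then - (c * a) else - (c * b))), (\row_i (if i == 0 then - b else a)).
split.
  apply/eqP => /rowP v0; have := v0 0; have := v0 1; rewrite !mxE/= => a0 b0.
  have := ab; rewrite a0 -(sqrrN b) b0 expr0n addr0 => /esym/eqP.
  by rewrite oner_eq0.
apply/seteqP; split=> [y|_ [t _ <-]]; rewrite /lin /=; last first.
  rewrite !mxE/=.
  have -> : a * (- (c * a) + t * - b) + b * (- (c * b) + t * a) + c = c * (1 - (a ^+ 2 + b ^+ 2)) by ring.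
  by rewrite ab subrr mulr0.
move=> y0; exists (a * y 0 1 - b * y 0 0) => //.
have cE : c = - (a * y 0 0 + b * y 0 1) by move: y0; lra.
apply/rowP => i; rewrite !mxE.
have [->|->] : i = 0 \/ i = 1.
  by case: i => [[|[|//]] i2]; [left|right]; exact: val_inj.
- have -> : - (c * a) + (a * y 0 1 - b * y 0 0) * - b = (a ^+ 2 + b ^+ 2) * y 0 0.
    by rewrite cE; ring.
  by rewrite ab mul1r.
have -> : - (c * b) + (a * y 0 1 - b * y 0 0) * a = (a ^+ 2 + b ^+ 2) * y 0 1.
  by rewrite cE; ring.
by rewrite ab mul1r.
Qed.

(** Twice the area of the triangle [x], [y], [y'] is computed in two ways: from its base on the line
    and its height [lin g x], and from the two sides at [x] and the sine of the angle between
    them. *)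
Lemma radial_line_bilip g x y y' (B : R) : unit_lin g -> lin g x != 0 ->
  lin g y = 0 -> lin g y' = 0 -> enorm (y - x) <= B -> enorm (y' - x) <= B ->
  enorm (y - y') <= 4 * B ^+ 2 / `|lin g x| * enorm (radial_proj x y - radial_proj x y').
Proof.
move=> g1 gx gy gy' yB y'B.
have yx : y != x by apply: contraNneq gx => <-; rewrite gy.
have y'x : y' != x by apply: contraNneq gx => <-; rewrite gy'.
have h0 : 0 < `|lin g x| by rewrite normr_gt0.
have [ga gb] := unit_lin_coord g1.
set f := radial_proj x y; set f' := radial_proj x y'; set E := enorm (f - f').
(* The signed length of [y - y'] along the line. *)
pose c := g.1.1 * (y 0 1 - y' 0 1) - g.1.2 * (y 0 0 - y' 0 0).
have tan : g.1.1 * (y 0 0 - y' 0 0) + g.1.2 * (y 0 1 - y' 0 1) = 0.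
  by move: gy gy'; rewrite /lin; lra.
have d0 : y 0 0 - y' 0 0 = - (g.1.2 * c).
  have -> : - (g.1.2 * c) = g.1.2 ^+ 2 * (y 0 0 - y' 0 0) -
      g.1.1 * (g.1.2 * (y 0 1 - y' 0 1)) by rewrite /c; ring.
  have -> : g.1.2 * (y 0 1 - y' 0 1) = - (g.1.1 * (y 0 0 - y' 0 0)) by move: tan; lra.
  by rewrite -[LHS]mul1r -g1; ring.
have d1 : y 0 1 - y' 0 1 = g.1.1 * c.
  have -> : g.1.1 * c = g.1.1 ^+ 2 * (y 0 1 - y' 0 1) -
      g.1.2 * (g.1.1 * (y 0 0 - y' 0 0)) by rewrite /c; ring.
  have -> : g.1.1 * (y 0 0 - y' 0 0) = - (g.1.2 * (y 0 1 - y' 0 1)) by move: tan; lra.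
  by rewrite -[LHS]mul1r -g1; ring.
have dc : enorm (y - y') <= 2 * `|c|.
  apply: enorm_le_coord; rewrite !mxE ?d0 ?d1 ?normrN normrM ler_piMl//.
have wedge : c * lin g x = enorm (y - x) * enorm (y' - x) *
    (f 0 1 * (f 0 0 - f' 0 0) - f 0 0 * (f 0 1 - f' 0 1)).
  have -> : lin g x = g.1.1 * (x 0 0 - y' 0 0) + g.1.2 * (x 0 1 - y' 0 1).
    by move: gy'; rewrite /lin; lra.
  transitivity (enorm (y - x) * f 0 0 * (enorm (y' - x) * f' 0 1) -
      enorm (y - x) * f 0 1 * (enorm (y' - x) * f' 0 0)); last by ring.
  rewrite -(radial_projE 0 yx) -(radial_projE 1 yx) -(radial_projE 0 y'x) -(radial_projE 1 y'x).
  transitivity ((y 0 0 - y' 0 0) * (y' 0 1 - x 0 1) - (y 0 1 - y' 0 1) * (y' 0 0 - x 0 0)).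
    by rewrite d0 d1; ring.
  ring.
have f1 : unit_lin (f 0 0, f 0 1, 0) by exact: radial_proj_unit.
have [/= fa fb] := unit_lin_coord f1.
have ch : `|c| * `|lin g x| <= B ^+ 2 * (2 * E).
  rewrite -normrM wedge normrM; apply: ler_pM => //.
    rewrite normrM !(ger0_norm (enorm_ge0 _)) expr2.
    by apply: ler_pM => //; exact: enorm_ge0.
  apply: le_trans (norm_MB_le fb (coordB_le_enorm f f' 0) fa (coordB_le_enorm f f' 1)) _.
  by rewrite -/E; lra.
apply: le_trans dc _; rewrite mulrAC ler_pdivlMr//; move: ch; lra.
Qed.

(** The Lipschitz constant in [radial_line_bilip] grows with the distance to [x], so the line is cut
    into countably many bounded pieces. *)
Lemma cnull_radial_line (K : set 'rV[R]_2) g x s : 0 < s -> unit_lin g -> lin g x != 0 ->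
  cnull s (radial_proj x @` (K `\ x)) -> cnull s (K `&` [set y | lin g y = 0]).
Proof.
move=> s0 g1 gx nP.
apply: (@sub_cnull _ _ s _ (\bigcup_m (K `&` [set y | lin g y = 0] `&`
    [set y | enorm (y - x) <= m%:R]))).
  move=> y Ky; exists (Num.bound (enorm (y - x))) => //; split=> //=.
  exact: ltW (archi_boundP (enorm_ge0 _)).
apply: bigcup_cnull => // m e e0.
pose L : R := 4 * m%:R ^+ 2 / `|lin g x| + 1.
have L0' : 0 <= 4 * m%:R ^+ 2 / `|lin g x| :> R.
  by rewrite divr_ge0// mulr_ge0// sqr_ge0.
have L0 : 0 < L by rewrite ltr_wpDl.
have [F [r [PF r0 Fr re]]] := cnull_scaled s0 nP L0 e0.
exists (fun k => [set y | F k (radial_proj x y)] `&` ([set y | lin g y = 0] `&`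
    [set y | enorm (y - x) <= m%:R])), r; split.
- move=> y [[Ky gy] ym].
  have yx : y != x by apply: contraNneq gx => <-; rewrite gy.
  have [|k _ Fk] := PF (radial_proj x y); last by exists k.
  by exists y => //; split=> //; exact/eqP.
- by move=> k; exact: ltW.
- move=> k y y' [/= Fy [/= gy ym]] [/= Fy' [/= gy' y'm]].
  apply: le_trans (ltW (Fr k _ _ Fy Fy')).
  apply: le_trans (radial_line_bilip g1 gx gy gy' ym y'm) _.
  by apply: ler_wpM2r; [exact: enorm_ge0|rewrite lerDl].
apply: lime_le; first by apply: is_cvg_nneseries => k _ _; rewrite lee_fin powR_ge0.
by apply: nearW => n; rewrite sumEFin lee_fin big_mkord.
Qed.

End Lines.

Theorem theorem1p4 (R : realType) (K : set 'rV[R]_2)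
  (K_borel : borel_set K) (K_dim : (0 < hausdorff_dim K)%E) :
  hausdorff_dim (InvT K) = 0%E \/
  exists2 L : set 'rV[R]_2, is_line L & InvT K `<=` L.
Proof.
have [[g [s [g1 s0 nK]]]|Kl] := pselect (exists g s, [/\ unit_lin g, 0 < s &
    ~ cnull s (K `&` [set y | lin g y = 0])]).
  right; exists [set y | lin g y = 0]; first exact: unit_line.
  move=> x /hausdorff_dim_eq0P Px /=; apply: contrapT => /eqP gx; apply: nK.
  exact: cnull_radial_line g1 gx (Px s s0).
left; apply/hausdorff_dim_eq0P => u u0.
have [s1 [s10 nK1]] : exists s, 0 < s /\ ~ cnull s K.
  apply: contrapT => H; move: K_dim; rewrite (_ : hausdorff_dim K = 0%E) ?ltxx//.
  apply/hausdorff_dim_eq0P => s s0; apply: contrapT => nK.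
  by apply: H; exists s.
(* At most [s1], so that [K] is not [s]-null, and at most [u], so that [s]-nullity of [InvT K]
   implies [u]-nullity. *)
pose s := Num.min u s1.
have s0 : 0 < s by rewrite lt_min u0.
have su : s <= u by rewrite ge_min lexx.
have nK : ~ cnull s K.
  by apply: contra_not nK1; apply: le_cnull => //; rewrite ge_min lexx orbT.
have [K' [mu [D [C [[cK' K'K K'D] [fmu mu1 muU muC]]]]]] := frostman_borel s0 K_borel nK.
apply: (le_cnull s0 su); apply: (@sub_cnull _ _ s _ (\bigcup_m (InvT K `&` box m%:R))).
  move=> x Px; exists (Num.bound (enorm x)) => //; split=> // i.
  exact: le_trans (coord_le_enorm x i) (ltW (archi_boundP (enorm_ge0 _))).
apply: bigcup_cnull => // m.
(* One box for both sets, with the extra 1 placing [K'] in the open square [osq 0 D']. *)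
pose D' : R := `|D| + 1 + m%:R.
have D'1 : 1 <= D' by rewrite /D' addrAC lerDr addr_ge0.
have m0 : 0 <= m%:R :> R by [].
have K'D' : K' `<=` osq 0 D'.
  move=> y /K'D yD; apply/osqE; rewrite !mxE !subr0 /D'.
  by have := yD 0; have := yD 1; have := ler_norm D; split; lra.
apply: (exceptional_null D'1 s0 cK' K'D' fmu muU muC).
- move=> x [_ xm] i; apply: le_trans (xm i) _.
  by rewrite /D' lerDr addr_ge0.
- move=> g g1; apply: (@sub_cnull _ _ s _ (K `&` [set y | lin g y = 0])).
    by move=> y [/K'K ? ?].
  by apply: contrapT => ng; apply: Kl; exists g, s.
move=> x [/hausdorff_dim_eq0P Px _].
apply: (@sub_cnull _ _ _ _ (radial_proj x @` (K `\ x))); last by apply: Px; rewrite divr_gt0.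
by move=> _ [y [/K'K Ky yx] <-]; exists y.
Qed.
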